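(* Let $F_1$ and $F_2$ be two geodesic Finsler structures on a smooth manifold $M$, and let $t\in(0,1)$. Then the following two conditions are equivalent: (A) the Finsler structure $(1-t)F_1+tF_2$ is a geodesic Finsler structure and it induces the metric $(1-t)d(F_1)+t\,d(F_2)$, i.e. $d((1-t)F_1+tF_2)=(1-t)d(F_1)+t\,d(F_2)$; (B) for every $x,y\in M$ there is an absolutely continuous path $\gamma$ joining $x$ to $y$ which is a geodesic with respect to both $F_1$ and $F_2$. Furthermore, in this case, any absolutely continuous path that is a geodesic for both $F_1$ and $F_2$ is also a geodesic for $(1-t)F_1+tF_2$.
   Context: A Finsler structure on a smooth manifold $M$ is a continuous function $F\colon TM\to[0,\infty)$ such that for every $x\in M$ the restriction $F(x,\cdot)$ to $T_xM$ is a weak norm, i.e. $F(x,v_1+v_2)\le F(x,v_1)+F(x,v_2)$ for all $v_1,v_2\in T_xM$; $F(x,\lambda v)=\lambda F(x,v)$ for all $\lambda\ge 0$ and $v\in T_xM$; and $F(x,v)=0$ if and only if $v=0$. (No symmetry and no further regularity is assumed.) The length of a piecewise $C^1$-path $\beta\colon[a,b]\to M$ is $l_F(\beta)=\int_a^bF(\beta(s),\dot\beta(s))\,ds$. The induced (possibly non-symmetric) metric $d(F)(x,y)$ is the infimum of $l_F(\beta)$ over all piecewise $C^1$-paths $\beta$ from $x$ to $y$. For a continuous path $\gamma\colon[a,b]\to M$, $l(d(F))(\gamma)$ is the supremum of $\sum_{i=0}^n d(F)(\gamma(t_i),\gamma(t_{i+1}))$ over all finite partitions $a=t_0\le t_1\le\dots\le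 t_{n+1}=b$. The path is a geodesic with respect to $F$ if it is continuous, $l(d(F))(\gamma)<\infty$ and $l(d(F))(\gamma)=d(F)(\gamma(a),\gamma(b))$. A path $\gamma\colon[a,b]\to M$ is absolutely continuous if, for the distance $d$ of a Riemannian metric on $M$ (the notion does not depend on its choice), for every $\epsilon>0$ there is $\delta>0$ such that for any disjoint intervals $(a_1,b_1),\dots,(a_n,b_n)$ in $[a,b]$ of total length less than $\delta$ one has $\sum_i d(\gamma(a_i),\gamma(b_i))<\epsilon$. A Finsler structure $F$ on $M$ is geodesic if every two points of $M$ can be joined by an absolutely continuous path which is a geodesic with respect to $F$. $((1-t)F_1+tF_2)(x,v)=(1-t)F_1(x,v)+tF_2(x,v)$, which is again a Finsler structure. *)

(* Defs.v *)
From HB Require Import structures.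
From mathcomp Require Import all_boot all_order all_algebra.
From mathcomp Require Import all_classical all_reals all_analysis.

Set Implicit Arguments.
Unset Strict Implicit.
Unset Printing Implicit Defensive.
Import Order.TTheory GRing.Theory Num.Theory.
Import numFieldNormedType.Exports.

Local Open Scope classical_set_scope.
Local Open Scope ring_scope.

(* [f] is of class C^k on the open set [O]. Only the values of [f] on [O]
   matter: both notions below are local at points of an open set. *)
Fixpoint Ck_on (R : realType) (V W : normedModType R) (k : nat) (O : set V)
    (f : V -> W) : Prop :=
  match k with
  | 0 => {in O, continuous f}
  | k'.+1 => {in O, forall x, differentiable f x} /\
             forall v : V, Ck_on k' O (fun x => 'D_v f x)
  end.

Definition smooth_on (R : realType) (V W : normedModType R) (O : set V)
    (f : V -> W) : Prop :=
  forall k, Ck_on k O f.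

(* [cmap] and [cinv] are total functions with irrelevant values outside
   [cdom] and [cmap @` cdom]. *)
Record chart (R : realType) (n : nat) (M : topologicalType) := Chart {
  cdom : set M ;
  cmap :> M -> 'rV[R]_n ;
  cinv : 'rV[R]_n -> M ;
  open_cdom : open cdom ;
  open_cimage : open (cmap @` cdom) ;
  cmapK : {in cdom, cancel cmap cinv} ;
  cmap_continuous : {in cdom, continuous cmap} ;
  cinv_continuous : {in cmap @` cdom, continuous cinv} }.

(* The smooth structure is the one generated by the atlas, which need not be
   maximal. [chart_at] selects a preferred chart around every point. It only
   serves to represent tangent vectors, see [tangent]. *)
Record smooth_manifold (R : realType) (n : nat) := SmoothManifold {
  carrier :> topologicalType ;
  manifold_hausdorff : hausdorff_space carrier ;
  manifold_second_countable : @second_countable carrier ;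
  atlas : set (chart R n carrier) ;
  atlas_smooth : forall c c', atlas c -> atlas c' ->
    smooth_on (c @` (cdom c `&` cdom c')) (c' \o cinv c) ;
  chart_at : carrier -> chart R n carrier ;
  chart_at_atlas : forall x, atlas (chart_at x) ;
  chart_at_dom : forall x, cdom (chart_at x) x }.

Section Finsler.
Context {R : realType} {n : nat} {M : smooth_manifold R n}.

(* A tangent vector at [x] is represented by its coordinates in the preferred
   chart at [x]; the vector space structure does not depend on that chart. *)
Definition tangent (x : M) := 'rV[R]_n.

(* The tangent vector at [x] with coordinates [v] in the chart [c]: the
   coordinate change is the Jacobian of the transition map. *)
Definition tangent_of (c : chart R n M) (x : M) (v : 'rV[R]_n) : tangent x :=
  'D_v (chart_at x \o cinv c) (c x).

Definition velocity (gamma : R -> M) (s : R) : tangent (gamma s) :=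
  derive1 (chart_at (gamma s) \o gamma) s.

(* The topology of TM is the one for which every
   [(x, v) |-> tangent_of c x v] is a homeomorphism from [cdom c * R^n] onto
   the open subset of TM lying over [cdom c]. *)
Definition continuous_TM (F : forall x : M, tangent x -> R) : Prop :=
  forall c, @atlas R n M c ->
    {in cdom c `*` setT,
      continuous (fun p : M * 'rV[R]_n => F p.1 (tangent_of c p.1 p.2))}.

Record finsler (F : forall x : M, tangent x -> R) : Prop := {
  finsler_continuous : continuous_TM F ;
  finsler_ge0 : forall x (v : tangent x), 0 <= F x v ;
  finsler_triangle : forall x (v1 v2 : tangent x),
    F x (v1 + v2) <= F x v1 + F x v2 ;
  finsler_homogeneous : forall x (v : tangent x) (lambda : R), 0 <= lambda ->
    F x (lambda *: v) = lambda * F x v ;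
  finsler_definite : forall x (v : tangent x), F x v = 0 <-> v = 0 }.

Record riemannian (g : forall x : M, tangent x -> tangent x -> R) : Prop := {
  riemannian_sym : forall x (v w : tangent x), g x v w = g x w v ;
  riemannian_linear : forall x (a : R) (u v w : tangent x),
    g x (a *: u + v) w = a * g x u w + g x v w ;
  riemannian_posdef : forall x (v : tangent x), v != 0 -> 0 < g x v v ;
  riemannian_smooth : forall (c : chart R n M) (v w : 'rV[R]_n), atlas c ->
    smooth_on (c @` cdom c)
      (fun u => g (cinv c u) (tangent_of c (cinv c u) v)
                             (tangent_of c (cinv c u) w) : R) }.

Definition C1_on (O : set R) (gamma : R -> M) : Prop :=
  {in O, continuous gamma} /\
  forall c : chart R n M, atlas c ->
    Ck_on 1 (O `&` gamma @^-1` cdom c) (c \o gamma).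

(* C^1 on a compact interval: restriction of a map which is C^1 on an open
   neighbourhood of it. *)
Definition C1_path (a b : R) (gamma : R -> M) : Prop :=
  exists (O : set R) (g : R -> M),
    [/\ open O, `[a, b] `<=` O, C1_on O g & {in `[a, b], gamma =1 g}].

Definition piecewise_C1 (a b : R) (beta : R -> M) : Prop :=
  {within `[a, b], continuous beta} /\
  exists (m : nat) (t : nat -> R),
    [/\ t 0%N = a, t m = b &
        forall i, (i < m)%N ->
          t i < t i.+1 /\ C1_path (t i) (t i.+1) beta].

(* At the finitely many break points [velocity] may be meaningless, which
   does not affect the Lebesgue integral. *)
Definition finsler_length (F : forall x : M, tangent x -> R) (a b : R)
    (beta : R -> M) : \bar R :=
  (\int[lebesgue_measure]_(s in `[a, b]) (F (beta s) (velocity beta s))%:E)%E.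

(* Equal to [+oo] when no piecewise C^1 path joins [x] to [y]. *)
Definition finsler_dist (F : forall x : M, tangent x -> R) (x y : M) : \bar R :=
  ereal_inf [set L : \bar R | exists (a b : R) (beta : R -> M),
    [/\ a <= b, beta a = x, beta b = y, piecewise_C1 a b beta
      & L = finsler_length F a b beta]].

Definition metric_length (d : M -> M -> \bar R) (a b : R)
    (gamma : R -> M) : \bar R :=
  ereal_sup [set L : \bar R | exists (m : nat) (t : nat -> R),
    [/\ t 0%N = a, t m.+1 = b, forall i, (i <= m)%N -> t i <= t i.+1
      & L = (\sum_(i < m.+1) d (gamma (t i)) (gamma (t i.+1)))%E]].

Definition is_geodesic (F : forall x : M, tangent x -> R) (a b : R)
    (gamma : R -> M) : Prop :=
  [/\ {within `[a, b], continuous gamma},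
      (metric_length (finsler_dist F) a b gamma < +oo)%E
    & metric_length (finsler_dist F) a b gamma =
      finsler_dist F (gamma a) (gamma b)].

Definition riemannian_dist (g : forall x : M, tangent x -> tangent x -> R) :
    M -> M -> \bar R :=
  finsler_dist (fun x v => Num.sqrt (g x v v)).

Definition abs_continuous (a b : R) (gamma : R -> M) : Prop :=
  exists2 g : forall x : M, tangent x -> tangent x -> R, riemannian g &
  forall eps : R, 0 < eps -> exists2 delta : R, 0 < delta &
  forall (m : nat) (p q : 'I_m -> R),
    (forall i, [/\ a <= p i, p i < q i & q i <= b]) ->
    trivIset setT (fun i => `]p i, q i[%classic) ->
    \sum_(i < m) (q i - p i) < delta ->
    (\sum_(i < m) riemannian_dist g (gamma (p i)) (gamma (q i)) < eps%:E)%E.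

Definition geodesic_finsler (F : forall x : M, tangent x -> R) : Prop :=
  finsler F /\
  forall x y : M, exists (a b : R) (gamma : R -> M),
    [/\ a <= b, gamma a = x, gamma b = y, abs_continuous a b gamma
      & is_geodesic F a b gamma].

Definition finsler_comb (t : R) (F1 F2 : forall x : M, tangent x -> R) :
    forall x : M, tangent x -> R :=
  fun x v => (1 - t) * F1 x v + t * F2 x v.

End Finsler.

Arguments tangent {R n} M x.

(* Main.v *)
Require Import Defs.
From mathcomp Require Import all_boot all_order all_algebra.
From mathcomp Require Import all_classical all_reals all_analysis.
From mathcomp Require Import measurable_realfun ring lra.

(** No differentiation of absolutely continuous paths is needed: the theorem
    follows from a local comparison of the metrics. Write F for the combination
    (1 - t) F1 + t F2, and let c be a chart around a point p0. Near p0, the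
    distance d(F)(x, y) of any Finsler structure is comparable, up to a factor
    1 + eps, to the norm of c y - c x at p0 ([finsler_dist_local_le],
    [finsler_dist_local_ge]). The norm of F at p0 is the combination of those of
    F1 and F2, hence locally d(F) <= (1 + eps)^2 ((1 - t) d(F1) + t d(F2)).

    A continuous path with endpoints at finite distance is a geodesic if and
    only if the distance is additive along it ([geodesic_additive],
    [additive_geodesic]). Along a common geodesic of F1 and F2 the metric
    (1 - t) d(F1) + t d(F2) is thus additive, and the local inequality chains up
    to a global one between the endpoints, with the same factor. Letting eps tend
    to 0 gives d(F) <= (1 - t) d(F1) + t d(F2); the reverse inequality is the
    linearity of the length. So under (B) the two metrics agree, and the common
    geodesics are geodesics of F. Under (A), additivity of d(F) along a geodesic
    of F splits into additivity of d(F1) and of d(F2), since each of them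
    satisfies the triangle inequality.

    In the local comparison, the upper bound is the length of a coordinate
    segment. For the lower bound, the norm of c p - c x, truncated so that it
    extends by a constant outside the chart, grows along every path at a rate of
    at most (1 + eps) times its speed ([finsler_length_calibration]). *)

Set Implicit Arguments.
Unset Strict Implicit.
Unset Printing Implicit Defensive.
Import Order.TTheory GRing.Theory Num.Theory.
Import numFieldNormedType.Exports.

Local Open Scope classical_set_scope.
Local Open Scope ring_scope.

(** * Continuous induction and integrals on intervals *)

(** Continuous induction: a transitive relation on [a, b] that holds for all
    u <= s <= v close enough to any given s holds between the endpoints. *)
Lemma straddle_ind (R : realType) (a b : R) (Q : R -> R -> Prop) :
  a <= b ->
  (forall u v w, a <= u -> u <= v -> v <= w -> w <= b ->
     Q u v -> Q v w -> Q u w) ->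
  (forall s, a <= s <= b -> exists2 e, 0 < e & forall u v,
     a <= u -> u <= s -> s <= v -> v <= b -> s - e < u -> v < s + e -> Q u v) ->
  Q a b.
Proof.
move=> ab Qtrans Qloc.
pose S := [set s | a <= s <= b /\ Q a s].
have aab : a <= a <= b by rewrite lexx ab.
have Sa : S a.
  split=> //; have [e e0 He] := Qloc a aab.
  by apply: He => //; rewrite ?ltrBlDr ltrDl.
have Sb : ubound S b by move=> s [/andP[]].
have hS : has_sup S by split; [exists a | exists b].
set s := sup S.
have sab : a <= s <= b.
  by apply/andP; split;
    [apply: ub_le_sup Sa; exists b | apply: ge_sup => //; exists a].
have /andP[as_ sb] := sab.
have [e e0 He] := Qloc s sab.
have [u [/andP[au ub] Qau] su] := sup_adherent e0 hS.
have us : u <= s by apply: ub_le_sup; [exists b | split=> //; rewrite au ub].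
have Ss v : s <= v -> v <= b -> v < s + e -> Q a v.
  by move=> sv vb ve; apply: (Qtrans a u v) => //; [exact: le_trans sv | apply: He].
have [sltb|] := ltP s b; last first.
  by move=> bs; apply: Ss => //; rewrite (le_lt_trans bs)// ltrDl.
pose v := Num.min b (s + e / 2).
have sv : s < v by rewrite lt_min sltb ltrDl divr_gt0.
have vb : v <= b by rewrite ge_min lexx.
have : S v.
  split; first by rewrite vb (le_trans as_ (ltW sv)).
  apply: Ss => //; first exact: ltW.
  by rewrite gt_min; apply/orP; right; lra.
by move=> /(ub_le_sup (ex_intro _ b Sb)); rewrite leNgt sv.
Qed.

Section interval_integrals.
Context {R : realType}.
Notation mu := (@lebesgue_measure R).
Local Open Scope ereal_scope.

Lemma measurable_itv_cat (u v w : R) (f : R -> \bar R) : (u <= v <= w)%R ->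
  measurable_fun `[u, v] f -> measurable_fun `[v, w] f ->
  measurable_fun `[u, w] f.
Proof.
move=> /andP[uv vw] m1 m2.
rewrite (@itv_bndbnd_setU _ _ _ (BRight v)) ?bnd_simp//.
apply/measurable_funU => //; split => //.
by apply: measurable_funS m2 => //; apply: subset_itvr; rewrite bnd_simp.
Qed.

Lemma integral_itv_cat (u v w : R) (f : R -> \bar R) : (u <= v <= w)%R ->
  measurable_fun `[u, w] f -> (forall x, 0 <= f x) ->
  \int[mu]_(x in `[u, w]) f x =
  \int[mu]_(x in `[u, v]) f x + \int[mu]_(x in `[v, w]) f x.
Proof.
move=> /andP[uv vw] mf f0.
have e : `[u, w]%classic = `[u, v] `|` `]v, w].
  by rewrite -itv_bndbnd_setU ?bnd_simp.
rewrite {1}e ge0_integral_setU//= -?e//; last first.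
  by apply/disj_set2P; rewrite -subset0 => x/= []; rewrite !in_itv/= =>
    /andP[_ xv] /andP[]; rewrite ltNge xv.
congr (_ + _); rewrite integral_itv_obnd_cbnd//.
by apply: measurable_funS mf => //; apply: subset_itvr; rewrite bnd_simp.
Qed.

Lemma integral_itv_translate (a b k : R) (f : R -> \bar R) :
  measurable_fun `[a, b] f -> (forall x, 0 <= f x) ->
  \int[mu]_(x in `[(a + k)%R, (b + k)%R]) f (x - k)%R =
  \int[mu]_(x in `[a, b]) f x.
Proof.
move=> mf f0.
pose phi : measurableTypeR R -> measurableTypeR R := fun x => (x - k)%R.
have mphi : measurable_fun setT phi.
  by apply: (@measurable_funB _ _ R) => //; exact: measurable_cst.
have e : `[(a + k)%R, (b + k)%R]%classic = phi @^-1` `[a, b]%classic.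
  by apply/seteqP; split => x /=; rewrite !in_itv/= /phi lerBrDr lerBlDr.
rewrite e -(ge0_integral_pushforward mphi mu) //=.
have -> // : \int[pushforward mu phi]_(y in `[a, b]) f y =
   \int[mu]_(y in `[a, b]) f y.
apply: eq_measure_integral => //= A mA _; apply/esym/lebesgue_measure_unique => //.
move=> _ [[x y]] _ <-.
transitivity (mu (phi @^-1` `]x, y]%classic)) => //.
rewrite (_ : phi @^-1` _ = `](x + k)%R, (y + k)%R]%classic); last first.
  by apply/seteqP; split => z /=; rewrite !in_itv/= /phi ltrBrDr lerBlDr.
rewrite !lebesgue_measure_itv/= !lte_fin ltrD2r.
by case: ifP => // _; congr EFin; ring.
Qed.
End interval_integrals.

(** A mean value inequality that asks for no differentiability of h: the
    increments of h across each s are controlled by the density psi s, up to an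
    arbitrarily small error per unit of length. *)
Lemma straddle_integral_le (R : realType) (a b : R) (h psi : R -> R) :
  a <= b -> {in `[a, b], continuous psi} -> (forall x, 0 <= psi x) ->
  (forall s eta, a <= s <= b -> 0 < eta -> exists2 e, 0 < e & forall u v,
     a <= u -> u <= s -> s <= v -> v <= b -> s - e < u -> v < s + e ->
     h v - h u <= (v - u) * (psi s + eta)) ->
  ((h b - h a)%:E <=
     \int[lebesgue_measure]_(x in `[a, b]) (psi x)%:E)%E.
Proof.
move=> ab cpsi psi0 H.
have mpsi : measurable_fun `[a, b] (fun x => (psi x)%:E).
  apply/measurable_EFinP; apply: subspace_continuous_measurable_fun => //.
  by apply: continuous_in_subspaceT => x; rewrite inE => xab; exact: cpsi.
have mpsiS u v : a <= u -> v <= b -> measurable_fun `[u, v] (fun x => (psi x)%:E).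
  by move=> au vb; apply: measurable_funS mpsi => //; apply: subset_itv;
    rewrite bnd_simp.
apply/lee_addgt0Pr => eps eps0.
(* The error eta per unit of length adds up to at most eps. *)
pose eta := eps / (b - a + 1).
have eta0 : 0 < eta by rewrite divr_gt0// ltr_wpDl ?subr_ge0.
pose Q u v := ((h v - h u - eta * (v - u))%:E <=
  \int[lebesgue_measure]_(x in `[u, v]) (psi x)%:E)%E.
suff : Q a b.
  rewrite /Q EFinB leeBlDr// => /le_trans; apply; apply: leeD => //.
  rewrite lee_fin /eta mulrAC ler_pdivrMr ?ltr_wpDl ?subr_ge0//.
  by rewrite ler_pM2l// lerDl.
apply: (@straddle_ind _ a b Q) => //.
  move=> u v w au uv vw wb Quv Qvw; rewrite /Q.
  rewrite (@integral_itv_cat _ u v w) ?uv ?vw//.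
    apply: le_trans (leeD Quv Qvw); rewrite -EFinD lee_fin le_eqVlt.
    by apply/orP; left; apply/eqP; ring.
  exact: mpsiS.
move=> s sab; have e20 : 0 < eta / 2 by rewrite divr_gt0.
have [e1 e10 H1] := H s _ sab e20.
have : \forall x \near s, psi s - eta / 2 < psi x.
  have cs : psi x @[x --> s] --> psi s by apply: cpsi; rewrite in_itv.
  by apply: (cvgr_gt _ cs); lra.
move=> /nbhs_ballP[e2 /= e2p H2].
exists (Num.min e1 e2); first by rewrite lt_min e10.
move=> u v au us sv vb; rewrite ltrBlDr => ue ve.
have uv : u <= v by exact: le_trans sv.
have {ue} [ue1 ue2] : s - e1 < u /\ s - e2 < u.
  by rewrite !ltrBlDr; split; apply: (lt_le_trans ue); rewrite lerD2l ge_min lexx ?orbT.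
have {ve} [ve1 ve2] : v < s + e1 /\ v < s + e2.
  by split; apply: (lt_le_trans ve); rewrite lerD2l ge_min lexx ?orbT.
rewrite /Q.
(* Truncation at 0 keeps the constant minorant nonnegative, as the monotonicity
   of the integral requires. *)
apply: (@le_trans _ _ (\int[lebesgue_measure]_(x in `[u, v])
    (cst (Num.max 0 (psi s - eta / 2))%:E x)))%E; last first.
  apply: ge0_le_integral => //.
  - by move=> x _; rewrite lee_fin le_max lexx.
  - exact: mpsiS.
  - move=> x /=; rewrite in_itv/= => /andP[ux xv].
    rewrite lee_fin ge_max psi0/= ltW//; apply: H2; rewrite /ball/= ltr_norml.
    by apply/andP; split; lra.
rewrite integral_cst//= lebesgue_measure_itv/= lte_fin.
have := H1 _ _ au us sv vb ue1 ve1 => H3.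
have [uv'|vu] := ltP u v.
  rewrite -EFinD -EFinM lee_fin.
  apply: (@le_trans _ _ ((psi s - eta / 2) * (v - u))); first by lra.
  by rewrite ler_pM2r ?subr_gt0// le_max lexx orbT.
have -> : v = u by apply/le_anti; rewrite vu uv.
by rewrite !subrr mulr0 mule0 subrr.
Qed.

(** * Norms read in a chart *)

Lemma dist_ratio_le (R : realFieldType) (N x y eps : R) : 0 < N -> 0 < eps ->
  `|N - x| < Num.min 1 eps / 8 * N -> `|N - y| < Num.min 1 eps / 8 * N ->
  x <= (1 + eps) * y /\ y <= (1 + eps) * x.
Proof.
move=> N0 eps0; set e := _ / 8 * N.
have m1 : Num.min 1 eps <= 1 by rewrite ge_min lexx.
have m2 : Num.min 1 eps <= eps by rewrite ge_min lexx orbT.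
have e1 : e <= N / 8 by rewrite /e; have := ler_wpM2r (ltW N0) m1; lra.
have e2 : e <= eps * N / 8 by rewrite /e; have := ler_wpM2r (ltW N0) m2; lra.
rewrite !ltr_distl => /andP[h1 h2] /andP[h3 h4].
have h5 : 0 <= eps * (x - N + N / 8) by apply: mulr_ge0; lra.
have h6 : 0 <= eps * (y - N + N / 8) by apply: mulr_ge0; lra.
split; lra.
Qed.

Lemma dist_half_bounds (R : realFieldType) (N x e : R) : 0 < N ->
  `|N - x| < N / 2 -> 0 < e -> e < Num.min (N / 2) (2 * N)^-1 ->
  e <= x <= e^-1.
Proof.
rewrite ltr_distl lt_min => N0 /andP[h1 h2] e0 /andP[e1 e2].
have x0 : 0 < x by lra.
apply/andP; split; first by lra.
rewrite -[leLHS]invrK lef_pV2 ?posrE ?invr_gt0//.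
by apply: (le_trans (ltW e2)); rewrite lef_pV2 ?posrE ?mulr_gt0//; lra.
Qed.

Section charts.
Context {R : realType} {n : nat} {M : smooth_manifold R n}.
Implicit Types (c : chart R n M) (p : M).

Lemma chart_cinvK c u : (c @` cdom c) u -> c (cinv c u) = u.
Proof. by move=> [q cq <-]; rewrite cmapK// inE. Qed.

Lemma cinv_chartK c p : cdom c p -> cinv c (c p) = p.
Proof. by move=> cp; rewrite cmapK// inE. Qed.

Lemma cinv_cdom c u : (c @` cdom c) u -> cdom c (cinv c u).
Proof. by move=> [q cq <-]; rewrite cinv_chartK. Qed.

Lemma near_cimage c p : cdom c p -> \forall u \near c p, (c @` cdom c) u.
Proof. by move=> cp; apply: open_nbhs_nbhs; split; [exact: open_cimage | exists p]. Qed.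

Lemma near_cdom c p : cdom c p -> \forall q \near p, cdom c q.
Proof. by move=> cp; apply: open_nbhs_nbhs; split => //; exact: open_cdom. Qed.

Lemma cinv_cvg c p : cdom c p -> cinv c u @[u --> c p] --> p.
Proof.
move=> cp; have : cinv c u @[u --> c p] --> cinv c (c p).
  by apply: (@cinv_continuous _ _ _ c); rewrite inE; exists p.
by rewrite cinv_chartK.
Qed.

Lemma chart_cvg c p : cdom c p -> c q @[q --> p] --> c p.
Proof. by move=> cp; apply: cmap_continuous; rewrite inE. Qed.

Lemma transition_differentiable c c' p : atlas c -> atlas c' ->
  cdom c p -> cdom c' p -> differentiable (c' \o cinv c) (c p).
Proof.
move=> ac ac' cp c'p; have [+ _] := @atlas_smooth _ _ M c c' ac ac' 1.
by apply; rewrite inE; exists p.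
Qed.

Lemma near_transition_id c c' p : cdom c p -> cdom c' p ->
  \forall u \near c p, ((c \o cinv c') \o (c' \o cinv c)) u = u.
Proof.
move=> cp c'p; have h1 := near_cimage cp.
have h2 : \forall u \near c p, cdom c' (cinv c u).
  by apply: (cinv_cvg cp); exact: near_cdom.
near=> u.
rewrite /= cinv_chartK; first by apply: chart_cinvK; near: u.
by near: u.
Unshelve. all: by end_near. Qed.

Lemma tangent_ofE c p : atlas c -> cdom c p ->
  tangent_of c p = 'd (chart_at p \o cinv c) (c p) :> (_ -> _).
Proof.
move=> ac cp; apply/funext => v; rewrite /tangent_of deriveE//.
by apply: transition_differentiable => //; [exact: chart_at_atlas|exact: chart_at_dom].
Qed.

(** The Jacobian of a transition map is invertible: the transition maps in the
    two directions compose to the identity near the point. *)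
Lemma tangent_of_inj c p v : atlas c -> cdom c p ->
  tangent_of c p v = 0 -> v = 0.
Proof.
move=> ac cp; rewrite tangent_ofE// => v0.
have ac' := chart_at_atlas p; have c'p := chart_at_dom p.
have d1 := transition_differentiable ac ac' cp c'p.
have d2 : differentiable (c \o cinv (chart_at p)) ((chart_at p \o cinv c) (c p)).
  by rewrite /= cinv_chartK//; exact: transition_differentiable.
have := near_eq_derive v (near_transition_id cp c'p).
rewrite derive_id => <-.
rewrite deriveE; last exact: differentiable_comp.
have -> : 'd ((c \o cinv (chart_at p)) \o (chart_at p \o cinv c)) (c p) v =
  'd (c \o cinv (chart_at p)) ((chart_at p \o cinv c) (c p))
  ('d (chart_at p \o cinv c) (c p) v).
  exact: (congr1 (fun f => f v) (diff_comp d1 d2)).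
set f := 'd _ _.
have {}v0 : ('d (chart_at p \o cinv c) (c p) v : 'rV[R]_n) = 0 := v0.
exact: etrans (congr1 f v0) (linear0 _).
Qed.

End charts.

Section coordinates.
Context {R : realType} {n : nat} {M : smooth_manifold R n}.
Variable F : forall x : M, tangent M x -> R.
Hypothesis hF : finsler F.
Implicit Types (c : chart R n M) (p : M) (v w : 'rV[R]_n).

(** The weak norm F(p, .) read in the chart c: v is a vector of coordinates
    in c, not in the preferred chart at p. *)
Definition coord_norm c p v : R := F (tangent_of c p v).

Lemma coord_norm_ge0 c p v : 0 <= coord_norm c p v.
Proof. exact: (finsler_ge0 hF). Qed.

Lemma coord_norm_gt0 c p v : atlas c -> cdom c p -> v != 0 ->
  0 < coord_norm c p v.
Proof.
move=> ac cp v0; rewrite lt_neqAle coord_norm_ge0 andbT eq_sym.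
apply: contra v0 => /eqP /(finsler_definite hF) /tangent_of_inj.
by move=> /(_ ac cp) ->.
Qed.

Lemma coord_normD c p v w : atlas c -> cdom c p ->
  coord_norm c p (v + w) <= coord_norm c p v + coord_norm c p w.
Proof.
move=> ac cp; rewrite /coord_norm tangent_ofE// linearD.
exact: (finsler_triangle hF).
Qed.

Lemma coord_normZ c p (k : R) v : atlas c -> cdom c p -> 0 <= k ->
  coord_norm c p (k *: v) = k * coord_norm c p v.
Proof.
move=> ac cp k0; rewrite /coord_norm tangent_ofE// linearZ.
exact: (finsler_homogeneous hF).
Qed.

Lemma coord_norm0 c p : atlas c -> cdom c p -> coord_norm c p 0 = 0.
Proof. by move=> ac cp; rewrite -(scale0r (0 : 'rV[R]_n)) coord_normZ// mul0r. Qed.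

Lemma coord_norm_cvg c p v : atlas c -> cdom c p ->
  coord_norm c q.1 q.2 @[q --> (p, v)] --> coord_norm c p v.
Proof.
move=> ac cp; have := finsler_continuous hF ac.
by move=> /(_ (p, v)); apply; rewrite inE.
Qed.

Lemma compact_sphere : compact [set v : 'rV[R]_n | `|v| = 1].
Proof.
apply: bounded_closed_compact.
  by exists 1; split => // x x1 v /= ->; exact: ltW.
have -> : [set v : 'rV[R]_n | `|v| = 1] = Num.norm @^-1` [set 1 : R] by [].
apply: preimage_closed; last exact: closed_eq.
by move=> v _; exact: norm_continuous.
Qed.

(** A tube lemma: a property that holds locally around each unit vector holds
    eventually for all unit vectors at once. *)
Lemma near_sphere (I : Type) (G : set_system I) (Q : I -> 'rV[R]_n -> Prop) :
  Filter G -> (forall v, `|v| = 1 -> \forall v' \near v & i \near G, Q i v') ->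
  \forall i \near G, forall v, `|v| = 1 -> Q i v.
Proof.
move=> FG H; have /compact_near_coveringP := compact_sphere.
move=> /(_ I G Q FG) /(_ H); apply: filterS => i Qi v v1; exact: Qi.
Qed.

(** Homogeneous statements need only be checked on the unit sphere. *)
Lemma unit_vector_ind (Q : 'rV[R]_n -> Prop) : Q 0 ->
  (forall k v, 0 <= k -> Q v -> Q (k *: v)) -> (forall v, `|v| = 1 -> Q v) ->
  forall v, Q v.
Proof.
move=> Q0 QZ Q1 v; have [->//|v0] := eqVneq v 0.
have -> : v = `|v| *: (`|v|^-1 *: v).
  by rewrite scalerA divff ?scale1r// normr_eq0.
apply: QZ => //; apply: Q1.
by rewrite normrZ normfV normr_id mulVf// normr_eq0.
Qed.

(** The norms F(p, .), read in a chart, depend continuously on p in a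
    multiplicative sense that is uniform in the vector. *)
Lemma coord_norm_near c p0 (eps : R) : atlas c -> cdom c p0 -> 0 < eps ->
  \forall p \near p0, forall v,
    coord_norm c p v <= (1 + eps) * coord_norm c p0 v /\
    coord_norm c p0 v <= (1 + eps) * coord_norm c p v.
Proof.
move=> ac cp eps0.
have H : \forall p \near p0, forall v, `|v| = 1 ->
    coord_norm c p v <= (1 + eps) * coord_norm c p0 v /\
    coord_norm c p0 v <= (1 + eps) * coord_norm c p v.
  apply: near_sphere => v v1.
  have N0 : 0 < coord_norm c p0 v.
    by apply: coord_norm_gt0 => //; rewrite -normr_gt0 v1.
  pose e := Num.min 1 eps / 8 * coord_norm c p0 v.
  have e0 : 0 < e by rewrite mulr_gt0// divr_gt0// lt_min eps0 ltr01.
  have /cvgrPdist_lt/(_ _ e0) := coord_norm_cvg (v := v) ac cp.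
  rewrite near_simpl /= => H.
  have H' : \forall v' \near v & p \near p0,
      `|coord_norm c p0 v - coord_norm c p v'| < e.
    by move: H => [[A B] [/= HA HB] AB]; exists (B, A) => //= -[x y] [/= Bx Ay];
      apply: (AB (y, x)).
  have H2 : \forall v' \near v & p \near p0,
      `|coord_norm c p0 v - coord_norm c p0 v'| < e.
    have [[A B] [/= HA HB] AB] := H'.
    exists (A, setT); first by split; [exact: HA | exact: filterT].
    move=> [x y] [/= Ax _]; apply: (AB (x, p0)); split => //=.
    exact: nbhs_singleton.
  apply: filterS2 H' H2 => -[x y] /=.
  exact: dist_ratio_le.
near=> p.
have cp' : cdom c p by near: p; exact: near_cdom.
apply: unit_vector_ind.
- by rewrite !coord_norm0// mulr0.
- move=> k v k0; rewrite !coord_normZ// => -[h1 h2].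
  by split; rewrite [leRHS]mulrCA;
    [exact: ler_wpM2l k0 _ _ h1 | exact: ler_wpM2l k0 _ _ h2].
- by near: p.
Unshelve. all: by end_near. Qed.

Lemma coord_norm_bounds c p : atlas c -> cdom c p ->
  exists m C : R, [/\ 0 < m, 0 < C &
    forall v, m * `|v| <= coord_norm c p v <= C * `|v|].
Proof.
move=> ac cp.
have H : \forall e \near 0^'+, forall v, `|v| = 1 ->
    e <= coord_norm c p v <= e^-1.
  apply: near_sphere => v v1.
  have N0 : 0 < coord_norm c p v.
    by apply: coord_norm_gt0 => //; rewrite -normr_gt0 v1.
  have e0 : 0 < coord_norm c p v / 2 by rewrite divr_gt0.
  have /cvgrPdist_lt/(_ _ e0) := coord_norm_cvg (v := v) ac cp.
  rewrite near_simpl /= => -[[A B] [/= HA HB] AB].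
  exists (B, [set e | 0 < e /\
    e < Num.min (coord_norm c p v / 2) (2 * coord_norm c p v)^-1]).
    split => //=; near=> e; split; near: e; first exact: nbhs_right_gt.
    by apply: nbhs_right_lt; rewrite lt_min e0 invr_gt0 mulr_gt0.
  move=> [x e] [/= Bx [e_gt0 e1]].
  have := AB (p, x) (conj (nbhs_singleton HA) Bx).
  by move=> /= h; apply: (dist_half_bounds N0 h).
have [e [e0 He]] : exists e : R, 0 < e /\ forall v, `|v| = 1 ->
    e <= coord_norm c p v <= e^-1.
  near (0 : R)^'+ => e; exists e; split; last by near: e.
  by near: e; exact: nbhs_right_gt.
exists e, e^-1; split => //; first by rewrite invr_gt0.
apply: unit_vector_ind.
- by rewrite !coord_norm0// normr0 !mulr0 lexx.
- move=> k v k0; rewrite !coord_normZ// normrZ ger0_norm// => /andP[h1 h2].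
  by apply/andP; split; rewrite mulrCA;
    [exact: ler_wpM2l k0 _ _ h1 | exact: ler_wpM2l k0 _ _ h2].
- by move=> v v1; rewrite v1 !mulr1 He.
Unshelve. all: by end_near. Qed.

End coordinates.

(** * Velocity and speed of C^1 curves *)

Section speed.
Context {R : realType} {n : nat} {M : smooth_manifold R n}.
Implicit Types (c : chart R n M) (p : M) (v w : 'rV[R]_n) (g beta : R -> M).

Lemma C1_on_cvg (O : set R) g s : C1_on O g -> O s -> g x @[x --> s] --> g s.
Proof. by move=> [cg _] Os; apply: cg; rewrite inE. Qed.

Lemma C1_on_near_cdom (O : set R) g s c : C1_on O g -> O s -> cdom c (g s) ->
  \forall x \near s, cdom c (g x).
Proof. by move=> C1g Os cs; apply: (C1_on_cvg C1g Os); exact: near_cdom. Qed.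

Lemma C1_on_differentiable (O : set R) g s c : C1_on O g -> O s -> atlas c ->
  cdom c (g s) -> differentiable (c \o g) s.
Proof.
move=> [_ C1g] Os ac cs; have [+ _] := C1g c ac.
by apply; rewrite inE.
Qed.

Lemma C1_on_derive_cvg (O : set R) g s c : C1_on O g -> O s -> atlas c ->
  cdom c (g s) -> (c \o g)^`()%classic x @[x --> s] --> (c \o g)^`()%classic s.
Proof.
move=> [_ C1g] Os ac cs; have [_ +] := C1g c ac.
move=> /(_ 1) /= H.
have -> : (c \o g)^`()%classic = 'D_1 (c \o g) by apply/funext => x; rewrite derive1E.
by apply: H; rewrite inE.
Qed.

(** The chain rule: the velocity may be computed in any chart of the
    atlas. *)
Lemma velocity_chart (O : set R) g s c : C1_on O g -> O s -> atlas c ->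
  cdom c (g s) -> velocity g s = tangent_of c (g s) ((c \o g)^`()%classic s).
Proof.
move=> C1g Os ac cs; rewrite /velocity !derive1E.
have d1 := C1_on_differentiable C1g Os ac cs.
have d2 : differentiable (chart_at (g s) \o cinv c) ((c \o g) s).
  by apply: transition_differentiable => //;
    [exact: chart_at_atlas | exact: chart_at_dom].
have -> : 'D_1 (chart_at (g s) \o g) s =
    'D_1 ((chart_at (g s) \o cinv c) \o (c \o g)) s.
  apply: near_eq_derive; near=> x; rewrite /= cinv_chartK//.
  by near: x; exact: C1_on_near_cdom C1g Os cs.
rewrite tangent_ofE// (deriveE _ d1) (deriveE _ (differentiable_comp d1 d2)).
exact: (congr1 (fun f => f 1) (diff_comp d1 d2)).
Unshelve. all: by end_near. Qed.

Lemma velocity_near_eq (F : forall x : M, tangent M x -> R) beta g s :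
  (\forall x \near s, beta x = g x) -> F _ (velocity beta s) = F _ (velocity g s).
Proof.
move=> bg; have e : beta s = g s by exact: (nbhs_singleton bg).
rewrite /velocity e !derive1E (@near_eq_derive _ _ _ _ (chart_at (g s) \o g))//.
by apply: filterS bg => x /= ->.
Qed.

Variable F : forall x : M, tangent M x -> R.
Hypothesis hF : finsler F.

(** The integrand of [finsler_length]. *)
Definition speed beta s : R := F (velocity beta s).

Lemma speed_ge0 beta s : 0 <= speed beta s.
Proof. exact: (finsler_ge0 hF). Qed.

Lemma speed_chart (O : set R) g s c : C1_on O g -> O s -> atlas c ->
  cdom c (g s) -> speed g s = coord_norm F c (g s) ((c \o g)^`()%classic s).
Proof. by move=> C1g Os ac cs; rewrite /speed (velocity_chart C1g Os ac cs). Qed.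

Lemma speed_cvg (O : set R) g s : open O -> C1_on O g -> O s ->
  speed g x @[x --> s] --> speed g s.
Proof.
move=> oO C1g Os.
have ac := chart_at_atlas (g s); have cs := chart_at_dom (g s).
set c := chart_at _ in ac cs.
rewrite (speed_chart C1g Os ac cs).
have : coord_norm F c (g x) ((c \o g)^`()%classic x) @[x --> s] -->
    coord_norm F c (g s) ((c \o g)^`()%classic s).
  apply: (@continuous2_cvg _ _ _ _ _ _ g (c \o g)^`()%classic (coord_norm F c)).
  - exact: (coord_norm_cvg hF ac cs).
  - exact: (C1_on_cvg C1g Os).
  - exact: (C1_on_derive_cvg C1g Os ac cs).
apply: cvg_trans; apply: near_eq_cvg.
have hO : \forall x \near s, O x by apply: open_nbhs_nbhs.
apply: filterS2 hO (C1_on_near_cdom C1g Os cs) => x Ox cx.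
by rewrite (speed_chart C1g Ox ac cx).
Qed.

End speed.

(** * Lengths and distances *)

Section finsler_lengths.
Context {R : realType} {n : nat} {M : smooth_manifold R n}.
Implicit Types (c : chart R n M) (g beta : R -> M).

(** The subdivision part of [piecewise_C1]. Continuity is omitted because it
    follows, see [piecewise_C1P]. *)
Definition C1_chain (a b : R) (beta : R -> M) : Prop :=
  exists (m : nat) (t : nat -> R), [/\ t 0%N = a, t m = b &
    forall i, (i < m)%N -> t i < t i.+1 /\ C1_path (t i) (t i.+1) beta].

Lemma C1_chain_ind (Q : R -> R -> Prop) a b beta :
  C1_chain a b beta ->
  (forall u, Q u u) ->
  (forall u v, u < v -> C1_path u v beta -> Q u v) ->
  (forall u v w, u <= v <= w -> Q u v -> Q v w -> Q u w) -> a <= b /\ Q a b.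
Proof.
move=> [m [t [<- <- H]]] Q0 Q1 Q2.
elim: m H => [|m IH] H; first by split.
have [i mi|le0m Q0m] := IH; first by apply: H; exact: ltnW.
have [lt1 C1] := H m (ltnSn m).
split; first exact: le_trans le0m (ltW lt1).
by apply: (Q2 _ (t m)) => //; [rewrite le0m ltW | exact: Q1].
Qed.

Lemma C1_path_within a b beta : C1_path a b beta ->
  {within `[a, b], continuous beta}.
Proof.
move=> [D [g [oO abO [cg _] bg]]].
apply: (@subspace_eq_continuous _ _ _ (g : subspace `[a, b] -> M)).
  by move=> x; rewrite inE => xab; rewrite [RHS]bg.
apply: continuous_in_subspaceT => x; rewrite inE => xab.
by apply: cg; rewrite inE; exact: abO.
Qed.

Lemma piecewise_C1P a b beta : piecewise_C1 a b beta <-> C1_chain a b beta.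
Proof.
split=> [[_ ch]|ch]; [exact: ch | split => //].
apply: (C1_chain_ind (Q := fun u v => {within `[u, v], continuous beta})
  ch _ _ _).2.
- by move=> u; rewrite set_itv1; exact: continuous_subspace1.
- by move=> u v _; exact: C1_path_within.
- move=> u v w /andP[uv vw] c1 c2.
  have -> : `[u, w]%classic = `[u, v] `|` `[v, w].
    apply/seteqP; split => x /=; rewrite !in_itv/=.
      by move=> /andP[ux xw]; case: (leP x v) => xv;
        [left; rewrite ux | right; rewrite xw ltW].
    by move=> [] /andP[h1 h2]; apply/andP; split => //;
      [exact: le_trans vw | exact: le_trans h1].
  by apply: withinU_continuous => //; exact: itv_closed.
Qed.

Lemma C1_path_eq a b beta beta' : {in `[a, b], beta =1 beta'} ->
  C1_path a b beta -> C1_path a b beta'.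
Proof.
move=> bb' [D [g [oO abO C1g bg]]]; exists D, g; split => // x xab.
by rewrite -bb'// bg.
Qed.

Variable F : forall x : M, tangent M x -> R.
Hypothesis hF : finsler F.

(** Only interior points are concerned: at the endpoints the two velocities
    may depend on the values outside [a, b]. *)
Lemma speed_eq a b beta beta' : {in `[a, b], beta =1 beta'} ->
  {in `]a, b[, speed F beta =1 speed F beta'}.
Proof.
move=> bb' s sab; apply: velocity_near_eq.
apply: filterS (near_in_itvoo sab) => x xab.
by apply: bb'; exact: subset_itv_oo_cc.
Qed.

Lemma measurable_speed_C1 a b beta : C1_path a b beta ->
  measurable_fun `[a, b] (fun s => (speed F beta s)%:E).
Proof.
move=> [D [g [oO abO C1g bg]]]; apply/measurable_EFinP.
apply: (@measurable_fun_itv_cc _ _ _ false true).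
apply: (@eq_measurable_fun _ _ _ _ _ (speed F g)).
  by move=> x; rewrite inE => xab; rewrite (speed_eq bg).
apply: open_continuous_measurable_fun => //.
move=> s; rewrite inE => sab; apply: (speed_cvg hF oO C1g).
by apply: abO; exact: subset_itv_oo_cc.
Qed.

Lemma measurable_speed a b beta : piecewise_C1 a b beta ->
  measurable_fun `[a, b] (fun s => (speed F beta s)%:E).
Proof.
move=> /piecewise_C1P pC; apply: (C1_chain_ind (Q := fun u v => measurable_fun `[u, v]
  (fun s => (speed F beta s)%:E)) pC _ _ _).2.
- by move=> u; rewrite set_itv1; exact: measurable_fun_set1.
- by move=> u v _; exact: measurable_speed_C1.
- by move=> u v w uvw; exact: measurable_itv_cat.
Qed.

Lemma finsler_length_eq a b beta beta' : {in `[a, b], beta =1 beta'} ->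
  measurable_fun `[a, b] (fun s => (speed F beta s)%:E) ->
  measurable_fun `[a, b] (fun s => (speed F beta' s)%:E) ->
  finsler_length F a b beta = finsler_length F a b beta'.
Proof.
move=> bb' /measurable_EFinP m1 /measurable_EFinP m2.
have sub : `]a, b[ `<=` `[a, b] by exact: subset_itv_oo_cc.
apply: (@eq_integral_itv_bounded _ _ _ (speed F beta') (speed F beta)).
- exact: measurable_funS m1.
- exact: measurable_funS m2.
- exact: speed_eq.
Qed.

Lemma finsler_length_ge0 a b beta : (0 <= finsler_length F a b beta)%E.
Proof. by apply: integral_ge0 => x _; rewrite lee_fin; exact: speed_ge0. Qed.

Lemma finsler_length_cat (u v w : R) beta : u <= v <= w ->
  measurable_fun `[u, w] (fun s => (speed F beta s)%:E) ->
  finsler_length F u w beta =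
  (finsler_length F u v beta + finsler_length F v w beta)%E.
Proof.
move=> uvw mb; apply: integral_itv_cat => // x.
by rewrite lee_fin; exact: speed_ge0.
Qed.

Lemma finsler_dist_ge0 x y : (0 <= finsler_dist F x y)%E.
Proof.
apply: le_ereal_inf_tmp => _ [a [b [beta [_ _ _ _ ->]]]].
exact: finsler_length_ge0.
Qed.

Lemma finsler_dist_le a b beta : a <= b -> piecewise_C1 a b beta ->
  (finsler_dist F (beta a) (beta b) <= finsler_length F a b beta)%E.
Proof. by move=> ab pC; apply: ereal_inf_lbound; exists a, b, beta. Qed.

Lemma derive1_translate (V : normedModType R) (f : R -> V) (k s : R) :
  derive1 (fun x => f (x - k)) s = derive1 f (s - k).
Proof. by rewrite /derive1; under eq_fun do rewrite -addrA. Qed.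

Lemma speed_translate beta k s :
  speed F (fun x => beta (x - k)) s = speed F beta (s - k).
Proof. by rewrite /speed /velocity (derive1_translate (_ \o beta)). Qed.

Lemma C1_path_translate a b beta k : C1_path a b beta ->
  C1_path (a + k) (b + k) (fun x => beta (x - k)).
Proof.
have sc (x : R) : (y - k) @[y --> x] --> x - k.
  by apply: cvgB; [exact: cvg_id | exact: cvg_cst].
move=> [D [g [oO abO [cg C1g] bg]]].
exists [set x | D (x - k)], (fun x => g (x - k)); split.
- by apply: (@open_comp _ _ (fun x => x - k)) => // x _; exact: sc.
- move=> x /=; rewrite in_itv/= => xab; apply: abO.
  by rewrite /= in_itv/= lerBrDr lerBlDr.
- split.
    move=> x; rewrite inE /= => Ox.
    apply: (@cvg_comp _ _ _ (fun x => x - k) g _ _ _ (sc x)).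
    by apply: cg; rewrite inE.
  move=> c ac; have [d1 d2] := C1g c ac.
  split=> [x|v x]; rewrite inE /= => -[Ox cx].
    apply: (@differentiable_comp _ _ _ _ (fun x => x - k) (c \o g)).
      by apply: differentiableB.
    by apply: d1; rewrite inE.
  have -> : (fun x => 'D_v (c \o (fun x => g (x - k))) x) =
      (fun x => 'D_v (c \o g) (x - k)).
    by apply/funext => y; rewrite /derive /=; under eq_fun do rewrite -addrA.
  apply: (@cvg_comp _ _ _ (fun x => x - k) ('D_v (c \o g)) _ _ _ (sc x)).
  by apply: d2; rewrite inE.
- move=> x; rewrite in_itv/= => xab; apply: bg.
  by rewrite in_itv/= lerBrDr lerBlDr.
Qed.

Lemma piecewise_C1_translate a b beta k : piecewise_C1 a b beta ->
  piecewise_C1 (a + k) (b + k) (fun x => beta (x - k)).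
Proof.
move=> /piecewise_C1P [m [t [t0 tm H]]]; apply/piecewise_C1P.
exists m, (fun i => t i + k); rewrite t0 tm; split => // i im.
by have [lt1 C1] := H i im; rewrite ltrD2r; split => //; exact: C1_path_translate.
Qed.

Lemma finsler_length_translate a b beta k : piecewise_C1 a b beta ->
  finsler_length F (a + k) (b + k) (fun x => beta (x - k)) =
  finsler_length F a b beta.
Proof.
move=> pC.
rewrite -[RHS](@integral_itv_translate _ _ _ k (fun x => (speed F beta x)%:E)).
- by apply: eq_integral => x _; rewrite -speed_translate.
- exact: measurable_speed.
- by move=> x; rewrite lee_fin; exact: speed_ge0.
Qed.

Lemma C1_chain_eq a b beta beta' : {in `[a, b], beta =1 beta'} ->
  C1_chain a b beta -> C1_chain a b beta'.
Proof.
move=> bb' [m [t [t0 tm H]]]; exists m, t; split => // i im.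
have [lt1 C1] := H i im; split => //; apply: C1_path_eq C1.
have tmono k j : (k + j <= m)%N -> t k <= t (k + j)%N.
  elim: j => [|j IH]; rewrite ?addn0// addnS => kj.
  by apply: (le_trans (IH (ltnW kj))); apply: ltW; have [] := H _ kj.
move=> x; rewrite in_itv/= => /andP[h1 h2]; apply: bb'; rewrite in_itv/=.
rewrite -t0 -tm; apply/andP; split.
  by apply: le_trans h1; rewrite -(add0n i); apply: tmono; exact: ltnW.
by apply: (le_trans h2); rewrite -(subnKC im); apply: tmono; rewrite subnKC.
Qed.

Lemma C1_chain_cat a b (c : R) beta : C1_chain a b beta -> C1_chain b c beta ->
  C1_chain a c beta.
Proof.
move=> [m1 [t1 [t10 t1m H1]]] [m2 [t2 [t20 t2m H2]]].
exists (m1 + m2)%N, (fun i => if (i <= m1)%N then t1 i else t2 (i - m1)%N).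
split.
- by rewrite leq0n.
- case: leqP => [|_]; last by rewrite addKn.
  rewrite -{2}(addn0 m1) leq_add2l leqn0 => /eqP m20.
  by rewrite m20 addn0 t1m -t2m m20 t20.
- move=> i im; have [im1|m1i] := ltnP i m1; first by rewrite ltnW//; exact: H1.
  have -> : (if (i <= m1)%N then t1 i else t2 (i - m1)%N) = t2 (i - m1)%N.
    case: leqP => // im1; have -> : i = m1 by apply/eqP; rewrite eqn_leq im1.
    by rewrite subnn t1m t20.
  by rewrite subSn//; apply: H2; rewrite ltn_subLR.
Qed.

(** Paths are concatenated after a translation of the parameter of the second
    one. *)
Lemma finsler_dist_triangle x y z :
  (finsler_dist F x z <= finsler_dist F x y + finsler_dist F y z)%E.
Proof.
have key L1 L2 : [set L : \bar R | exists (a b : R) (beta : R -> M),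
    [/\ a <= b, beta a = x, beta b = y, piecewise_C1 a b beta
      & L = finsler_length F a b beta]] L1 ->
    [set L : \bar R | exists (a b : R) (beta : R -> M),
    [/\ a <= b, beta a = y, beta b = z, piecewise_C1 a b beta
      & L = finsler_length F a b beta]] L2 -> (finsler_dist F x z <= L1 + L2)%E.
  move=> [a [b [b1 [ab b1a b1b pC1 ->]]]] [a' [b' [b2 [ab' b2a b2b pC2 ->]]]].
  pose k := b - a'; pose c := b' + k.
  have a'k : a' + k = b by rewrite /k addrC subrK.
  rewrite -(finsler_length_translate k pC2).
  have := piecewise_C1_translate k pC2; rewrite a'k -/c => pC2'.
  pose b3 s := if s <= b then b1 s else b2 (s - k).
  have e1 : {in `[a, b], b1 =1 b3}.
    by move=> s; rewrite in_itv/= /b3 => /andP[_ ->].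
  have e2 : {in `[b, c], (fun s => b2 (s - k)) =1 b3}.
    move=> s; rewrite in_itv/= /b3 => /andP[bs _].
    case: leP => // sb; have -> : s = b by apply/le_anti; rewrite bs sb.
    by rewrite b1b -a'k addrK.
  have bc : b <= c by rewrite -a'k lerD2r.
  have q1 : C1_chain a b b3 by apply: C1_chain_eq e1 _; exact/piecewise_C1P.
  have q2 : C1_chain b c b3 by apply: C1_chain_eq e2 _; exact/piecewise_C1P.
  have q3 : piecewise_C1 a c b3 by apply/piecewise_C1P; exact: C1_chain_cat q1 q2.
  rewrite (finsler_length_eq e1) ?(finsler_length_eq e2).
  - rewrite -finsler_length_cat ?ab ?bc//; last exact: measurable_speed.
    have -> : x = b3 a by rewrite -e1 ?b1a// in_itv/= lexx ab.
    have -> : z = b3 c by rewrite -e2 ?in_itv/= ?bc ?lexx// /c addrK.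
    by apply: finsler_dist_le => //; exact: le_trans bc.
  - exact: measurable_speed.
  - by apply: measurable_speed; exact/piecewise_C1P.
  - exact: measurable_speed.
  - by apply: measurable_speed; exact/piecewise_C1P.
have [->|dxy] := eqVneq (finsler_dist F x y) +oo%E.
  by rewrite addye ?leey// gt_eqF// (lt_le_trans _ (finsler_dist_ge0 _ _)).
have [->|dyz] := eqVneq (finsler_dist F y z) +oo%E.
  by rewrite addey ?leey// gt_eqF// (lt_le_trans _ (finsler_dist_ge0 _ _)).
have f1 : finsler_dist F x y \is a fin_num.
  by rewrite ge0_fin_numE ?finsler_dist_ge0// ltey.
have f2 : finsler_dist F y z \is a fin_num.
  by rewrite ge0_fin_numE ?finsler_dist_ge0// ltey.
apply/lee_addgt0Pr => e e0; have e20 : 0 < e / 2 by rewrite divr_gt0.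
have [L1 S1 h1] := lb_ereal_inf_adherent e20 f1.
have [L2 S2 h2] := lb_ereal_inf_adherent e20 f2.
apply: (le_trans (key _ _ S1 S2)).
apply: (le_trans (leeD (ltW h1) (ltW h2))).
rewrite addeACA -EFinD -splitr//.
Qed.

(** Lower bounds on lengths by calibration: if rho grows along C^1 curves at a
    rate of at most K times their speed, then K times the length of a path bounds
    the increment of rho from one endpoint to the other. Neither rho nor its
    restriction to curves need be differentiable. *)
Lemma finsler_length_calibration a b beta (rho : M -> R) (K : R) : 0 <= K ->
  piecewise_C1 a b beta ->
  (forall (D : set R) g (s eta : R), open D -> C1_on D g -> D s -> 0 < eta ->
    exists2 e : R, 0 < e & forall u v, u <= s -> s <= v ->
      s - e < u -> v < s + e ->
      rho (g v) - rho (g u) <= (v - u) * (K * speed F g s + eta)) ->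
  ((rho (beta b) - rho (beta a))%:E <= K%:E * finsler_length F a b beta)%E.
Proof.
move=> K0 /piecewise_C1P pC H.
pose Q (u v : R) := measurable_fun `[u, v] (fun s => (speed F beta s)%:E) /\
  ((rho (beta v) - rho (beta u))%:E <= K%:E * finsler_length F u v beta)%E.
apply: (C1_chain_ind (Q := Q) pC _ _ _).2.2.
- move=> u; split; first by rewrite set_itv1; exact: measurable_fun_set1.
  by rewrite subrr mule_ge0// ?finsler_length_ge0.
- move=> u v uv C1b; have m1 := measurable_speed_C1 C1b; split => //.
  have [D [g [oO abO C1g bg]]] := C1b.
  have C1g' : C1_path u v g by exists D, g; split.
  have m2 := measurable_speed_C1 C1g'.
  rewrite (finsler_length_eq bg m1 m2) !bg ?in_itv/= ?lexx ?(ltW uv)//.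
  rewrite /finsler_length -ge0_integralZl//; last first.
    by move=> x _; rewrite lee_fin; exact: speed_ge0.
  apply: (@straddle_integral_le _ u v (rho \o g) (fun s => K * speed F g s)).
  + exact: ltW.
  + move=> x xuv; apply: cvgMr; apply: (speed_cvg hF oO C1g); exact: abO.
  + by move=> x; rewrite mulr_ge0//; exact: speed_ge0.
  + move=> s eta suv eta0; have Os : D s by apply: abO; rewrite /= in_itv.
    have [e e0 He] := H D g s eta oO C1g Os eta0.
    by exists e => // u' v' _ us sv _; exact: He.
- move=> u v w uvw [m1 h1] [m2 h2].
  have m3 := measurable_itv_cat uvw m1 m2; split => //.
  rewrite (finsler_length_cat uvw m3) ge0_muleDr ?finsler_length_ge0//.
  apply: le_trans (leeD h1 h2); rewrite -EFinD lee_fin le_eqVlt.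
  by apply/orP; left; apply/eqP; ring.
Qed.

End finsler_lengths.

Section combination.
Context {R : realType} {n : nat} {M : smooth_manifold R n}.
Variables (F1 F2 : forall x : M, tangent M x -> R) (t : R).
Hypotheses (hF1 : finsler F1) (hF2 : finsler F2) (t0 : 0 < t) (t1 : t < 1).

Lemma finsler_comb_finsler : finsler (finsler_comb t F1 F2).
Proof.
have t1' : 0 < 1 - t by rewrite subr_gt0.
split.
- move=> c ac p pc; apply: cvgD; apply: cvgMr.
    exact: (finsler_continuous hF1 ac).
  exact: (finsler_continuous hF2 ac).
- move=> x v; rewrite addr_ge0// mulr_ge0// ?(ltW t0) ?(ltW t1')//.
    exact: (finsler_ge0 hF1).
  exact: (finsler_ge0 hF2).
- move=> x v w; rewrite /finsler_comb addrACA -!mulrDr.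
  apply: lerD; (apply: ler_wpM2l; first exact: ltW).
    exact: (finsler_triangle hF1).
  exact: (finsler_triangle hF2).
- move=> x v k k0; rewrite /finsler_comb (finsler_homogeneous hF1)//.
  rewrite (finsler_homogeneous hF2)//.
  by rewrite mulrDr mulrCA [in X in _ + X]mulrCA.
- move=> x v; rewrite /finsler_comb; split => [|->].
    move=> /eqP; rewrite paddr_eq0; last 2 first.
    + by rewrite mulr_ge0 ?(ltW t1')//; exact: (finsler_ge0 hF1).
    + by rewrite mulr_ge0 ?(ltW t0)//; exact: (finsler_ge0 hF2).
    by rewrite mulf_eq0 (gt_eqF t1')/= => /andP[/eqP /(finsler_definite hF1)].
  by rewrite (finsler_definite hF1 _).2// (finsler_definite hF2 _).2// !mulr0 addr0.
Qed.

Lemma finsler_length_comb a b beta : piecewise_C1 a b beta ->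
  finsler_length (finsler_comb t F1 F2) a b beta =
  ((1 - t)%:E * finsler_length F1 a b beta + t%:E * finsler_length F2 a b beta)%E.
Proof.
have t1' : 0 < 1 - t by rewrite subr_gt0.
move=> pC; rewrite /finsler_length.
have m1 := measurable_speed hF1 pC; have m2 := measurable_speed hF2 pC.
rewrite -ge0_integralZl//; last 2 first.
- by move=> x _; rewrite lee_fin; exact: (finsler_ge0 hF1).
- by rewrite lee_fin ltW.
rewrite -ge0_integralZl//; last 2 first.
- by move=> x _; rewrite lee_fin; exact: (finsler_ge0 hF2).
- by rewrite lee_fin ltW.
rewrite -ge0_integralD//.
- by move=> x _; apply: mule_ge0; rewrite lee_fin;
    [exact: ltW | exact: (finsler_ge0 hF1)].
- exact: measurable_funeM.
- by move=> x _; apply: mule_ge0; rewrite lee_fin;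
    [exact: ltW | exact: (finsler_ge0 hF2)].
- exact: measurable_funeM.
Qed.

Lemma finsler_dist_comb_ge x y :
  ((1 - t)%:E * finsler_dist F1 x y + t%:E * finsler_dist F2 x y <=
   finsler_dist (finsler_comb t F1 F2) x y)%E.
Proof.
have t1' : 0 < 1 - t by rewrite subr_gt0.
apply: le_ereal_inf_tmp => _ [a [b [beta [ab <- <- pC ->]]]].
rewrite finsler_length_comb//;
apply: leeD; (apply: lee_wpmul2l; first by rewrite lee_fin ltW).
  exact: finsler_dist_le.
exact: finsler_dist_le.
Qed.
End combination.

(** * Local comparison of the distance with a norm *)

Lemma derive_line (R : realType) (V W : normedModType R) (f : V -> W)
    (x v : V) (k s : R) :
  'D_k (fun r : R => f (x + r *: v)) s = 'D_(k *: v) f (x + s *: v).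
Proof.
rewrite /derive; apply: (congr1 (fun g : R -> W => lim (g h @[h --> 0^']))).
apply/funext => h /=.
by rewrite -[h *: k]/(h * k) scalerDl scalerA addrCA.
Qed.

(** Increments across a point of differentiability: the error is controlled by
    the length of the whole interval [u, v] around s. *)
Lemma differentiable_strict_estimate (R : realType) (V : normedModType R)
    (f : R -> V) (s e : R) : differentiable f s -> 0 < e ->
  exists2 d : R, 0 < d & forall u v, u <= s -> s <= v -> s - d < u -> v < s + d ->
    `|f v - f u - (v - u) *: derive1 f s| <= e * (v - u).
Proof.
move=> /diff_derivable - /(_ 1) df e0.
have /cvgrPdist_le/(_ e e0) :
    h^-1 *: ((f \o shift s) (h *: 1) - f s) @[h --> 0^'] --> derive1 f s.
  by rewrite derive1E; exact: df.
move=> [/= d d0 Hd]; exists d => //.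
have est h : `|h| < d -> `|f (h + s) - f s - h *: derive1 f s| <= e * `|h|.
  have [->|h0 hd] := eqVneq h 0.
    by rewrite add0r subrr scale0r subrr !normr0 mulr0.
  have := Hd h; rewrite /= sub0r normrN => /(_ hd h0).
  rewrite -[_ *: 1]/(h * 1) mulr1 => H.
  have -> : f (h + s) - f s - h *: derive1 f s =
      - (h *: (derive1 f s - h^-1 *: (f (h + s) - f s))).
    by rewrite scalerBr scalerA divff// scale1r opprB.
  by rewrite normrN normrZ mulrC ler_wpM2r.
move=> u v us sv du vd.
have hv := est (v - s); have hu := est (u - s).
rewrite !subrK in hv hu.
rewrite ger0_norm ?subr_ge0// in hv; rewrite ler0_norm ?subr_le0// opprB in hu.
have {}hv := hv (ltac:(by rewrite ltrBlDl)).
have {}hu := hu (ltac:(by rewrite ltrBlDr -ltrBlDl)).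
have e1 : f v - f u = (f v - f s) - (f u - f s) by rewrite opprB addrA subrK.
have e2 : (v - u) *: derive1 f s = (v - s) *: derive1 f s - (u - s) *: derive1 f s.
  by rewrite -scalerBl opprB addrA subrK.
rewrite e1 e2.
move: (f v - f s) (f u - f s) ((v - s) *: _) ((u - s) *: _) hv hu => A B C D hv hu.
have -> : A - B - (C - D) = (A - C) - (B - D).
  by rewrite !opprB addrACA [RHS]addrACA [- B - C]addrC.
apply: (le_trans (ler_normB _ _)); apply: (le_trans (lerD hv hu)).
by rewrite -mulrDr addrA subrK.
Qed.

Lemma ball_segment (R : realType) (V : normedModType R) (z x y : V) (r s : R) :
  0 <= s <= 1 -> `|z - x| < r -> `|z - y| < r -> `|z - (x + s *: (y - x))| < r.
Proof.
move=> /andP[s0 s1] zx zy.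
have -> : z - (x + s *: (y - x)) = (1 - s) *: (z - x) + s *: (z - y).
  have -> : z - y = (z - x) - (y - x) by rewrite opprB addrA subrK.
  by rewrite [s *: (_ - (y - x))]scalerBr addrA -scalerDl subrK scale1r opprD addrA.
apply: (le_lt_trans (ler_normD _ _)); rewrite !normrZ !ger0_norm ?subr_ge0//.
have [->|s_neq0] := eqVneq s 0; first by rewrite subr0 mul1r mul0r addr0.
have sgt0 : 0 < s by rewrite lt_neqAle eq_sym s_neq0.
have h1 : (1 - s) * `|z - x| <= (1 - s) * r by rewrite ler_wpM2l ?subr_ge0// ltW.
have h2 : s * `|z - y| < s * r by rewrite ltr_pM2l.
by apply: (lt_le_trans (ler_ltD h1 h2)); rewrite -mulrDl subrK mul1r.
Qed.

Section local_comparison.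
Context {R : realType} {n : nat} {M : smooth_manifold R n}.
Implicit Types (c : chart R n M).
Variable F : forall x : M, tangent M x -> R.
Hypothesis hF : finsler F.

(** A coordinate ball on which all the norms are comparable to the one at the
    centre. *)
Lemma coord_norm_ball c p0 (eps : R) : atlas c -> cdom c p0 -> 0 < eps ->
  exists2 r : R, 0 < r & forall u, `|c p0 - u| < r -> (c @` cdom c) u /\
    forall v,
    coord_norm F c (cinv c u) v <= (1 + eps) * coord_norm F c p0 v /\
    coord_norm F c p0 v <= (1 + eps) * coord_norm F c (cinv c u) v.
Proof.
move=> ac cp eps0.
have H1 := near_cimage cp.
have H2 : \forall u \near c p0, forall v,
    coord_norm F c (cinv c u) v <= (1 + eps) * coord_norm F c p0 v /\
    coord_norm F c p0 v <= (1 + eps) * coord_norm F c (cinv c u) v.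
  exact: (cinv_cvg cp (coord_norm_near hF ac cp eps0)).
have /nbhs_ballP[r /= r0 Hr] : nbhs (c p0) [set u | (c @` cdom c) u /\ forall v,
    coord_norm F c (cinv c u) v <= (1 + eps) * coord_norm F c p0 v /\
    coord_norm F c p0 v <= (1 + eps) * coord_norm F c (cinv c u) v].
  exact: filterI.
exists r => // u ur; apply: (Hr u).
by rewrite -ball_normE.
Qed.

Lemma line_cvg (x v : 'rV[R]_n) (s : R) : x + y *: v @[y --> s] --> x + s *: v.
Proof. by apply: cvgD; [exact: cvg_cst | apply: cvgZr_tmp; exact: cvg_id]. Qed.

Lemma C1_on_chart_line c (O : set R) (x v : 'rV[R]_n) : atlas c ->
  (forall s, O s -> (c @` cdom c) (x + s *: v)) ->
  C1_on O (fun s => cinv c (x + s *: v) : M).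
Proof.
move=> ac HO; split.
  move=> s; rewrite inE => Os.
  have cc : cinv c u @[u --> x + s *: v] --> cinv c (x + s *: v).
    by apply: (@cinv_continuous _ _ _ c); rewrite inE; exact: HO.
  exact: (cvg_comp _ _ (line_cvg (v := v) (s := s)) cc).
move=> c' ac'; split => [s|k s]; rewrite inE => -[/= Os c's].
  have -> : c' \o (fun s => cinv c (x + s *: v)) =
    (c' \o cinv c) \o (fun s => x + s *: v) by [].
  apply: differentiable_comp.
    by apply: differentiableD => //; apply: differentiableZl.
  have [+ _] := @atlas_smooth _ _ M c c' ac ac' 1; apply; rewrite inE.
  exists (cinv c (x + s *: v)); last exact: chart_cinvK (HO _ Os).
  by split => //; exact: cinv_cdom (HO _ Os).
have -> : (fun y => 'D_k (c' \o (fun s => cinv c (x + s *: v))) y) =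
    (fun y => 'D_(k *: v) (c' \o cinv c) (x + y *: v)).
  by apply/funext => y; exact: (derive_line (c' \o cinv c)).
have [_ /(_ (k *: v)) /= dc] := @atlas_smooth _ _ M c c' ac ac' 1.
have cc : 'D_(k *: v) (c' \o cinv c) u @[u --> x + s *: v] -->
    'D_(k *: v) (c' \o cinv c) (x + s *: v).
  apply: dc; rewrite inE.
  exists (cinv c (x + s *: v)); last exact: chart_cinvK (HO _ Os).
  by split => //; exact: cinv_cdom (HO _ Os).
exact: (cvg_comp _ _ (line_cvg (v := v) (s := s)) cc).
Qed.

Lemma speed_chart_line c (x v : 'rV[R]_n) (s : R) :
  (c @` cdom c) (x + s *: v) ->
  speed F (fun s => cinv c (x + s *: v) : M) s =
  coord_norm F c (cinv c (x + s *: v)) v.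
Proof.
move=> im; rewrite /speed /velocity /coord_norm /tangent_of.
rewrite derive1E (derive_line (chart_at _ \o cinv c)) scale1r.
by rewrite chart_cinvK.
Qed.

(** The upper bound comes from the length of the coordinate segment. *)
Lemma finsler_dist_local_le c p0 (eps : R) : atlas c -> cdom c p0 -> 0 < eps ->
  exists2 U : set M, nbhs p0 U & forall x y, U x -> U y ->
    (finsler_dist F x y <= ((1 + eps) * coord_norm F c p0 (c y - c x))%:E)%E.
Proof.
move=> ac cp eps0; have [r r0 Hr] := coord_norm_ball ac cp eps0.
exists [set p | cdom c p /\ `|c p0 - c p| < r].
  apply: filterI; first exact: near_cdom.
  by have /cvgrPdist_lt/(_ r r0) := chart_cvg cp.
move=> x y [cx xr] [cy yr].
pose v := c y - c x.
pose beta s : M := cinv c (c x + s *: v).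
pose D : set R := [set s | `|c p0 - (c x + s *: v)| < r].
have oD : open D.
  have -> : D = (fun s => c x + s *: v) @^-1` ball (c p0) r.
    by rewrite -ball_normE.
  apply: open_comp; last exact: ball_open.
  by move=> s _; exact: line_cvg.
have imD s : D s -> (c @` cdom c) (c x + s *: v) by move=> /Hr[].
have D01 : `[0, 1] `<=` D.
  by move=> s /=; rewrite in_itv/= => s01; exact: ball_segment.
have C1b : C1_path 0 1 beta.
  by exists D, beta; split => //; exact: C1_on_chart_line.
have pC : piecewise_C1 0 1 beta.
  apply/piecewise_C1P; exists 1%N, (fun i => i%:R); split => // -[|//] _.
  by split => //; exact: ltr01.
have b0 : beta 0 = x by rewrite /beta scale0r addr0 cinv_chartK.
have b1 : beta 1 = y by rewrite /beta scale1r addrC subrK cinv_chartK.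
rewrite -{1}b0 -{1}b1; apply: (le_trans (finsler_dist_le F ler01 pC)).
have N0 : 0 <= (1 + eps) * coord_norm F c p0 v.
  by apply: mulr_ge0; [rewrite addr_ge0// ltW | exact: coord_norm_ge0].
apply: (@le_trans _ _ (\int[lebesgue_measure]_(s in `[0%R, 1%R])
  (cst ((1 + eps) * coord_norm F c p0 v)%:E s)))%E.
  apply: ge0_le_integral => //.
  - by move=> s _; rewrite lee_fin; exact: speed_ge0.
  - exact: (measurable_speed hF pC).
  - move=> s /D01 Ds; rewrite lee_fin -/(speed F beta s) speed_chart_line; last exact: imD.
    by have [_ /(_ v)[]] := Hr _ Ds.
rewrite integral_cst//= lebesgue_measure_itv/= lte_fin ltr01.
by rewrite -EFinD subr0 -EFinM mulr1.
Qed.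

End local_comparison.

Lemma min_lipschitz (R : realDomainType) (a b k d : R) : 0 <= d -> a <= b + d ->
  Num.min a k - Num.min b k <= d.
Proof.
move=> d0 abd; rewrite lerBlDr addrC.
have [bk|kb] := leP b k.
  by rewrite ge_min abd.
by rewrite ge_min lerDl d0 orbT.
Qed.

Section local_comparison_ge.
Context {R : realType} {n : nat} {M : smooth_manifold R n}.
Implicit Types (c : chart R n M).
Variable F : forall x : M, tangent M x -> R.
Hypothesis hF : finsler F.

(** A closed coordinate ball is compact, hence closed in M since M is
    Hausdorff. *)
Lemma closed_chart_ball c p0 (r : R) :
  (forall u, `|c p0 - u| <= r -> (c @` cdom c) u) ->
  closed [set p : M | cdom c p /\ `|c p0 - c p| <= r].
Proof.
move=> Hr; apply: compact_closed; first exact: manifold_hausdorff.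
have -> : [set p : M | cdom c p /\ `|c p0 - c p| <= r] =
    cinv c @` [set u | `|c p0 - u| <= r].
  apply/seteqP; split => [p [cp pr]|_ [u ur <-]].
    by exists (c p) => //; rewrite cinv_chartK.
  by split; [exact: cinv_cdom (Hr _ ur) | rewrite chart_cinvK//; exact: Hr].
apply: continuous_compact.
  apply: continuous_in_subspaceT => u; rewrite inE => ur.
  by apply: cinv_continuous; rewrite inE; exact: Hr.
have -> : [set u | `|c p0 - u| <= r] = closed_ball_ Num.norm (c p0) r by [].
apply: bounded_closed_compact; last exact: closed_closed_ball_.
exists (`|c p0| + r); split; first exact: num_real.
move=> k hk u /= ur; apply: le_trans (ltW hk).
have -> : u = c p0 - (c p0 - u) by rewrite subKr.
by apply: (le_trans (ler_normB _ _)); rewrite lerD2l.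
Qed.

Lemma coord_norm_incr c p (C : R) (u v w D : 'rV[R]_n) (k e : R) :
  atlas c -> cdom c p -> 0 <= C -> 0 <= k ->
  (forall v, coord_norm F c p v <= C * `|v|) ->
  `|v - u - k *: D| <= e ->
  coord_norm F c p (v - w) <= coord_norm F c p (u - w) +
    (k * coord_norm F c p D + C * e).
Proof.
move=> ac cp C0 k0 HC he.
have -> : v - w = (u - w) + (k *: D + (v - u - k *: D)).
  by rewrite [k *: D + _]addrC subrK [RHS]addrC addrA subrK.
apply: (le_trans (coord_normD hF _ _ ac cp)); rewrite lerD2l.
apply: (le_trans (coord_normD hF _ _ ac cp)); rewrite (coord_normZ hF)//.
by rewrite lerD2l; apply: (le_trans (HC _)); apply: ler_wpM2l.
Qed.

(** The lower bound has to take into account the paths that leave the chart. It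
    comes from the calibration by the norm of c p - c x truncated at a level k,
    which extends by the constant k outside a closed coordinate ball. *)
Lemma finsler_dist_local_ge c p0 (eps : R) : atlas c -> cdom c p0 -> 0 < eps ->
  exists2 U : set M, nbhs p0 U & forall x y, U x -> U y ->
    ((coord_norm F c p0 (c y - c x))%:E <= (1 + eps)%:E * finsler_dist F x y)%E.
Proof.
move=> ac cp eps0; have [r r0 Hr] := coord_norm_ball hF ac cp eps0.
have [m [C [m0 C0 mC]]] := coord_norm_bounds hF ac cp.
have r20 : 0 < r / 2 by rewrite divr_gt0.
have r2r : r / 2 < r by rewrite gtr_pMr// invf_lt1// ltr1n.
pose B := [set p : M | cdom c p /\ `|c p0 - c p| <= r / 2].
have clB : closed B.
  by apply: closed_chart_ball => u ur; have [] := Hr u (le_lt_trans ur r2r).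
(* Points at coordinate distance at least r / 2 from p0 are at distance at least
   r / 4 from every x with |c p0 - c x| < r / 4, so their norm relative to x
   reaches the truncation level k. *)
pose k := m * (r / 4).
have k0 : 0 < k by rewrite mulr_gt0// divr_gt0.
(* The second bound keeps c y - c x below the truncation level. *)
pose r' := Num.min (r / 4) (k / (2 * C)).
have r'0 : 0 < r' by rewrite lt_min !divr_gt0// mulr_gt0.
exists [set p | cdom c p /\ `|c p0 - c p| < r'].
  apply: filterI; first exact: near_cdom.
  by have /cvgrPdist_lt/(_ r' r'0) := chart_cvg cp.
move=> x y [cx xr] [cy yr].
pose N := coord_norm F c p0.
have N_ge0 v : 0 <= N v by exact: coord_norm_ge0.
have xr4 : `|c p0 - c x| < r / 4 by apply: (lt_le_trans xr); rewrite ge_min lexx.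
have Nxy : N (c y - c x) <= k.
  have /andP[_ h] := mC (c y - c x); apply: (le_trans h).
  have -> : c y - c x = (c p0 - c x) - (c p0 - c y) by rewrite opprB [RHS]addrC addrA subrK.
  have h1 : `|(c p0 - c x) - (c p0 - c y)| <= r' + r'.
    by apply: (le_trans (ler_normB _ _)); apply: lerD; exact: ltW.
  apply: (@le_trans _ _ (C * (r' + r'))); first by apply: ler_wpM2l => //; exact: ltW.
  have h2 : r' <= k / (2 * C) by rewrite ge_min lexx orbT.
  have -> : k = C * (k / (2 * C) + k / (2 * C)).
    by clear -C0; field; rewrite gt_eqF.
  by apply: ler_wpM2l; [exact: ltW | exact: lerD].
have Nfar p : cdom c p -> r / 2 < `|c p0 - c p| -> k <= N (c p - c x).
  move=> cp' pr; have /andP[h _] := mC (c p - c x); apply: le_trans h.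
  rewrite /k; apply: ler_wpM2l; first exact: ltW.
  have h1 : `|c p0 - c p| <= `|c p0 - c x| + `|c p - c x|.
    have -> : c p0 - c p = (c p0 - c x) - (c p - c x).
      by rewrite opprB addrA subrK.
    exact: ler_normB.
  move: (`|c p0 - c p|) (`|c p0 - c x|) (`|c p - c x|) pr xr4 h1.
  by clear => a b d; lra.
pose rho (p : M) : R := if pselect (B p) then Num.min (N (c p - c x)) k else k.
have rhoE p : cdom c p -> rho p = Num.min (N (c p - c x)) k.
  move=> cp'; rewrite /rho; case: pselect => // nBp.
  rewrite min_r// Nfar// ltNge; apply/negP => h; exact: nBp.
have key : forall (D : set R) (g : R -> M) (s eta : R), open D -> C1_on D g ->
    D s -> 0 < eta ->
    exists2 e : R, 0 < e & forall u v, u <= s -> s <= v ->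
      s - e < u -> v < s + e ->
      rho (g v) - rho (g u) <= (v - u) * ((1 + eps) * speed F g s + eta).
  move=> D g s eta oD C1g Ds eta0.
  have sp0 : 0 <= (1 + eps) * speed F g s + eta.
    apply: addr_ge0; last exact: ltW.
    by apply: mulr_ge0; [rewrite addr_ge0// ltW | exact: speed_ge0].
  have gs := C1_on_cvg C1g Ds.
  have [[cs sr]|nB] := pselect (B (g s)); last first.
    (* Away from the closed set B, rho is locally constant. *)
    have /nbhs_ballP[e /= e0 He] : \forall z \near s, ~ B (g z).
      have oB : nbhs (g s) (~` B).
        by apply: open_nbhs_nbhs; split => //; exact: closed_openC.
      exact: (gs _ oB).
    exists e => // u v us sv ue ve.
    have nBz z : `|s - z| < e -> rho (g z) = k.
      by move=> sz; rewrite /rho; case: pselect => // Bz; have := He z sz.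
    rewrite !nBz ?subrr.
    - by rewrite mulr_ge0// subr_ge0 (le_trans us).
    - by rewrite ger0_norm ?subr_ge0// ltrBlDr -ltrBlDl.
    - by rewrite ler0_norm ?subr_le0// opprB ltrBlDl.
  have [e1 e10 He1] : exists2 e : R, 0 < e & forall z, `|s - z| < e -> cdom c (g z).
    by have /nbhs_ballP[e /= e0 He] := C1_on_near_cdom C1g Ds cs; exists e.
  have eC : 0 < eta / C by rewrite divr_gt0.
  have [e2 e20 He2] :=
    differentiable_strict_estimate (C1_on_differentiable C1g Ds ac cs) eC.
  exists (Num.min e1 e2); first by rewrite lt_min e10.
  move=> u v us sv; rewrite ltrBlDr => ue ve.
  have uv : u <= v by exact: le_trans sv.
  have {ue} [ue1 ue2] : s - e1 < u /\ s - e2 < u.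
    by rewrite !ltrBlDr; split; apply: (lt_le_trans ue); rewrite lerD2l ge_min lexx ?orbT.
  have {ve} [ve1 ve2] : v < s + e1 /\ v < s + e2.
    by split; apply: (lt_le_trans ve); rewrite lerD2l ge_min lexx ?orbT.
  have cu : cdom c (g u).
    by apply: He1; rewrite ger0_norm ?subr_ge0// ltrBlDr -ltrBlDl.
  have cv : cdom c (g v) by apply: He1; rewrite ler0_norm ?subr_le0// opprB ltrBlDl.
  rewrite !rhoE//; apply: min_lipschitz.
    by rewrite mulr_ge0// subr_ge0.
  have uv0 : 0 <= v - u by rewrite subr_ge0.
  have est := He2 u v us sv ue2 ve2.
  have C0' := ltW C0.
  have HC w : coord_norm F c p0 w <= C * `|w| by have /andP[] := mC w.
  apply: (le_trans (coord_norm_incr (c x) ac cp C0' uv0 HC est)).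
  rewrite lerD2l [leRHS]mulrDr; apply: lerD.
    rewrite (speed_chart F C1g Ds ac cs); apply: ler_wpM2l => //.
    have := Hr (c (g s)) (le_lt_trans sr r2r).
    by rewrite cinv_chartK// => -[_ /(_ (derive1 (c \o g) s))[]].
  by rewrite mulrA mulrCA divff ?gt_eqF// mulr1 mulrC.
have main a b beta : a <= b -> piecewise_C1 a b beta -> beta a = x -> beta b = y ->
    ((N (c y - c x))%:E <= (1 + eps)%:E * finsler_length F a b beta)%E.
  move=> ab pC bx by_.
  have eps1 : 0 <= 1 + eps by rewrite addr_ge0// ltW.
  have := finsler_length_calibration hF eps1 pC key.
  have N00 : N 0 = 0 by exact: coord_norm0.
  rewrite bx by_ !rhoE// subrr N00 (min_l Nxy) (min_l (ltW k0)).
  by rewrite subr0.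
have eps1 : 0 < 1 + eps by rewrite addr_gt0.
rewrite -lee_pdivrMl//.
apply: le_ereal_inf_tmp => _ [a [b [beta [ab bx by_ pC ->]]]].
by rewrite lee_pdivrMl//; exact: main.
Qed.

End local_comparison_ge.

(** * Geodesics and convex combinations *)

Lemma adde_squeeze (R : realType) (A B C D E T : \bar R) :
  (0 <= A -> 0 <= B -> 0 <= C -> 0 <= D -> 0 <= E -> E <= B + C ->
   A + (B + (C + D)) <= T -> T <= A + (E + D) -> T < +oo ->
   E < +oo /\ B + C = E)%E.
Proof.
case: T => [T||] //; last first.
  by move=> A0 B0 C0 D0 _ _ h _ _; have := le_trans (adde_ge0 A0
    (adde_ge0 B0 (adde_ge0 C0 D0))) h.
case: A => [A||]//; case: B => [B||]//; case: C => [C||]//; case: D => [D||]//;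
  case: E => [E||]//.
rewrite -!EFinD !lee_fin => *; split; first by rewrite ltey.
by congr EFin; lra.
Qed.

Lemma square_factor_le (R : realFieldType) (D e x : R) : 0 < x -> x <= 1 ->
  0 <= D -> x * (3 * (D + 1)) <= e -> (1 + x) * (1 + x) * D <= D + e.
Proof.
move=> x0 x1 D0 h.
have x2 : 0 <= x * (1 - x) by rewrite mulr_ge0 ?subr_ge0// ltW.
have := mulr_ge0 x2 D0; lra.
Qed.

Lemma convex_squeeze (R : realFieldType) (t a1 b1 c1 a2 b2 c2 : R) :
  0 < t -> t < 1 -> c1 <= a1 + b1 -> c2 <= a2 + b2 ->
  (1 - t) * a1 + t * a2 + ((1 - t) * b1 + t * b2) = (1 - t) * c1 + t * c2 ->
  a1 + b1 = c1 /\ a2 + b2 = c2.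
Proof.
move=> t0 t1 h1 h2 h.
have p1 : 0 <= (1 - t) * (a1 + b1 - c1) by rewrite mulr_ge0 ?subr_ge0// ltW.
have p2 : 0 <= t * (a2 + b2 - c2) by rewrite mulr_ge0 ?subr_ge0// ltW.
have q1 : (1 - t) * (a1 + b1 - c1) = 0 by lra.
have q2 : t * (a2 + b2 - c2) = 0 by lra.
split; apply/eqP; rewrite -subr_eq0.
  by move/eqP: q1; rewrite mulf_eq0 [1 - t == 0]subr_eq0 (gt_eqF t1).
by move/eqP: q2; rewrite mulf_eq0 (gt_eqF t0).
Qed.

Lemma convex_squeeze_ereal (R : realType) (t : R) (A1 B1 C1 A2 B2 C2 : \bar R) :
  0 < t -> t < 1 ->
  A1 \is a fin_num -> B1 \is a fin_num -> C1 \is a fin_num ->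
  A2 \is a fin_num -> B2 \is a fin_num -> C2 \is a fin_num ->
  (C1 <= A1 + B1 -> C2 <= A2 + B2 ->
   ((1 - t)%:E * A1 + t%:E * A2) + ((1 - t)%:E * B1 + t%:E * B2) =
     (1 - t)%:E * C1 + t%:E * C2 ->
   A1 + B1 = C1 /\ A2 + B2 = C2)%E.
Proof.
move=> t0 t1; case: A1 => // A1 _; case: B1 => // B1 _; case: C1 => // C1 _.
case: A2 => // A2 _; case: B2 => // B2 _; case: C2 => // C2 _.
rewrite -!EFinM -!EFinD !lee_fin => h1 h2 [] h.
by have [-> ->] := convex_squeeze t0 t1 h1 h2 h.
Qed.

Section geodesics.
Context {R : realType} {n : nat} {M : smooth_manifold R n}.
Variable F : forall x : M, tangent M x -> R.
Hypothesis hF : finsler F.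
Notation d := (finsler_dist F).

(** Equality in the triangle inequality along gamma. For a continuous path with
    endpoints at finite distance this is equivalent to being a geodesic. *)
Definition additive_along (a b : R) (gamma : R -> M) : Prop :=
  forall u v w, a <= u -> u <= v -> v <= w -> w <= b ->
  (d (gamma u) (gamma v) + d (gamma v) (gamma w) = d (gamma u) (gamma w))%E.

Lemma geodesic_additive (a b : R) gamma : is_geodesic F a b gamma ->
  additive_along a b gamma.
Proof.
move=> [_ Lfin LE] u v w au uv vw wb.
have d0 := finsler_dist_ge0 hF.
have tri := finsler_dist_triangle hF.
(* The subdivision a <= u <= v <= w <= b leaves no room in the triangle
   inequality between u, v and w. *)
pose ts := [:: a; u; v; w; b].
have L4 : (d (gamma a) (gamma u) + (d (gamma u) (gamma v) +
    (d (gamma v) (gamma w) + d (gamma w) (gamma b))) <=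
    metric_length d a b gamma)%E.
  apply: ereal_sup_ubound; exists 3%N, (fun i => nth b ts i); split => //.
    by move=> [|[|[|[|]]]].
  by rewrite !big_ord_recl big_ord0 adde0.
rewrite LE in L4 Lfin.
have [] := @adde_squeeze R _ _ _ _ (d (gamma u) (gamma w)) _ (d0 _ _) (d0 _ _)
  (d0 _ _) (d0 _ _) (d0 _ _) (tri _ _ _) L4 _ Lfin => //.
apply: (le_trans (tri _ (gamma u) _)); apply: leeD => //.
Qed.

Lemma additive_geodesic (a b : R) gamma : a <= b ->
  {within `[a, b], continuous gamma} -> (d (gamma a) (gamma b) < +oo)%E ->
  additive_along a b gamma -> is_geodesic F a b gamma.
Proof.
move=> ab cg dfin add.
suff LE : metric_length d a b gamma = d (gamma a) (gamma b) by split; rewrite ?LE.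
apply/eqP; rewrite eq_le; apply/andP; split; last first.
  apply: ereal_sup_ubound; exists 0%N, (fun i => if i is 0%N then a else b).
  by split => //; [case | rewrite big_ord_recl big_ord0 adde0].
apply: ge_ereal_sup => _ [m [t [t0 tm tmono ->]]].
have tle i j : (i + j <= m.+1)%N -> t i <= t (i + j)%N.
  elim: j => [|j IH]; rewrite ?addn0// addnS => ij.
  exact: le_trans (IH (ltnW ij)) (tmono _ _).
suff H k : (k <= m)%N -> (\sum_(i < k.+1) d (gamma (t i)) (gamma (t i.+1)) =
    d (gamma a) (gamma (t k.+1)))%E by rewrite H// tm.
elim: k => [_|k IH km]; first by rewrite big_ord1/= t0.
rewrite big_ord_recr/= IH 1?ltnW//; apply: add => //.
- by rewrite -t0; apply: (tle 0%N k.+1); exact: leqW.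
- exact: tmono.
- by rewrite -tm -(subnKC (_ : (k.+2 <= m.+1)%N))//; apply: tle; rewrite subnKC.
Qed.

Lemma geodesic_finsler_dist_fin : geodesic_finsler F ->
  forall x y, (d x y < +oo)%E.
Proof.
by move=> [_ H] x y; have [a [b [g [_ <- <- _ [_ + <-]]]]] := H x y.
Qed.

End geodesics.

Section comparison.
Context {R : realType} {n : nat} {M : smooth_manifold R n}.
Variables (F1 F2 : forall x : M, tangent M x -> R) (t : R).
Hypotheses (hF1 : finsler F1) (hF2 : finsler F2) (t0 : 0 < t) (t1 : t < 1).
Let F := finsler_comb t F1 F2.

(** The metric (1 - t) d(F1) + t d(F2). *)
Definition dist_comb (x y : M) : \bar R :=
  ((1 - t)%:E * finsler_dist F1 x y + t%:E * finsler_dist F2 x y)%E.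

Lemma weight_ge0 : 0 <= 1 - t. Proof. by rewrite subr_ge0 ltW. Qed.

Lemma dist_comb_ge0 x y : (0 <= dist_comb x y)%E.
Proof.
by apply: adde_ge0; apply: mule_ge0; rewrite ?lee_fin ?weight_ge0 ?(ltW t0)//;
  exact: finsler_dist_ge0.
Qed.

(** Near a point both sides are comparable to the same norm on coordinates,
    because the norm of the combination is the combination of the norms. *)
Lemma finsler_dist_comb_local_le (p0 : M) (eps : R) : 0 < eps ->
  exists2 U : set M, nbhs p0 U & forall x y, U x -> U y ->
    (finsler_dist F x y <= ((1 + eps) * (1 + eps))%:E * dist_comb x y)%E.
Proof.
move=> eps0; have ac := chart_at_atlas p0; have cp := chart_at_dom p0.
have hF : finsler F by exact: finsler_comb_finsler.
have [U nU HU] := finsler_dist_local_le hF ac cp eps0.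
have [U1 nU1 HU1] := finsler_dist_local_ge hF1 ac cp eps0.
have [U2 nU2 HU2] := finsler_dist_local_ge hF2 ac cp eps0.
exists (U `&` (U1 `&` U2)); first by do 2!apply: filterI => //.
move=> x y [Ux [U1x U2x]] [Uy [U1y U2y]].
have e0 : 0 <= 1 + eps by rewrite addr_ge0// ltW.
apply: (le_trans (HU _ _ Ux Uy)); rewrite EFinM EFinM -muleA.
apply: lee_wpmul2l; first by rewrite lee_fin.
rewrite /coord_norm /F /finsler_comb EFinD !EFinM.
rewrite ge0_muleDr; last 2 first.
- apply: mule_ge0; first by rewrite lee_fin weight_ge0.
  exact: finsler_dist_ge0.
- apply: mule_ge0; first by rewrite lee_fin ltW.
  exact: finsler_dist_ge0.
rewrite [X in (_ <= X + _)%E]muleCA [X in (_ <= _ + X)%E]muleCA.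
apply: leeD; apply: lee_wpmul2l; rewrite ?lee_fin ?weight_ge0 ?(ltW t0)//.
  exact: HU1.
exact: HU2.
Qed.

Lemma dist_comb_additive (a b : R) (gamma : R -> M) u v w :
  additive_along F1 a b gamma -> additive_along F2 a b gamma ->
  a <= u -> u <= v -> v <= w -> w <= b ->
  (dist_comb (gamma u) (gamma v) + dist_comb (gamma v) (gamma w) =
   dist_comb (gamma u) (gamma w))%E.
Proof.
move=> add1 add2 au uv vw wb; rewrite /dist_comb addeACA.
rewrite -!ge0_muleDr ?(finsler_dist_ge0 hF1) ?(finsler_dist_ge0 hF2)//.
by rewrite (add1 u v w)// (add2 u v w).
Qed.

(** The crucial equality. Along a common geodesic the right-hand side is
    additive, so the local comparison propagates by [straddle_ind] with the same
    factor (1 + eps)^2. *)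
Lemma finsler_dist_comb_geodesic (a b : R) (gamma : R -> M) : a <= b ->
  is_geodesic F1 a b gamma -> is_geodesic F2 a b gamma ->
  finsler_dist F (gamma a) (gamma b) = dist_comb (gamma a) (gamma b).
Proof.
move=> ab g1 g2; apply/eqP; rewrite eq_le; apply/andP; split; last first.
  exact: finsler_dist_comb_ge.
have hF : finsler F by exact: finsler_comb_finsler.
have add1 := geodesic_additive hF1 g1; have add2 := geodesic_additive hF2 g2.
have cg : {within `[a, b], continuous gamma} by case: g1.
have main (eps : R) : 0 < eps -> (finsler_dist F (gamma a) (gamma b) <=
    ((1 + eps) * (1 + eps))%:E * dist_comb (gamma a) (gamma b))%E.
  move=> eps0.
  have e0 : (0 <= ((1 + eps) * (1 + eps))%:E)%E.
    by rewrite lee_fin mulr_ge0// addr_ge0// ltW.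
  apply: (@straddle_ind _ a b (fun u v => finsler_dist F (gamma u) (gamma v) <=
    ((1 + eps) * (1 + eps))%:E * dist_comb (gamma u) (gamma v))%E) => //.
    move=> u v w au uv vw wb Quv Qvw.
    apply: (le_trans (finsler_dist_triangle hF _ (gamma v) _)).
    apply: (le_trans (leeD Quv Qvw)); rewrite -ge0_muleDr ?dist_comb_ge0//.
    by rewrite (dist_comb_additive add1 add2).
  move=> s sab; have [U nU HU] := finsler_dist_comb_local_le (gamma s) eps0.
  have sab' : `[a, b]%classic s by rewrite /= in_itv.
  have /nbhs_ballP[e /= e_gt0 He] : \forall z \near s, `[a, b]%classic z -> U (gamma z).
    have /subspace_continuousP/(_ s sab') cs := cg.
    exact: (cs _ nU).
  exists e => // u v au us sv vb ue ve.
  have ub : u <= b by exact: le_trans us (le_trans sv vb).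
  have av : a <= v by exact: le_trans au (le_trans us sv).
  apply: HU; apply: He.
  - by rewrite -ball_normE /= ger0_norm ?subr_ge0// ltrBlDr -ltrBlDl.
  - by rewrite /= in_itv /= au.
  - by rewrite -ball_normE /= ler0_norm ?subr_le0// opprB ltrBlDl.
  - by rewrite /= in_itv /= av.
have [->|Dfin] := eqVneq (dist_comb (gamma a) (gamma b)) +oo%E.
  exact: leey.
have D0 := dist_comb_ge0 (gamma a) (gamma b).
have fD : dist_comb (gamma a) (gamma b) \is a fin_num by rewrite ge0_fin_numE// ltey.
move: main D0; rewrite -(fineK fD); set D := fine _ => main.
rewrite lee_fin => D0.
apply/lee_addgt0Pr => e e_gt0.
pose eps := Num.min 1 (e / (3 * (D + 1))).
have D1 : 0 < 3 * (D + 1) by rewrite mulr_gt0// ltr_wpDl.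
have eps_gt0 : 0 < eps by rewrite lt_min ltr01 divr_gt0.
apply: (le_trans (main _ eps_gt0)); rewrite -EFinM -EFinD lee_fin.
have h1 : eps <= 1 by rewrite ge_min lexx.
have h2 : eps * (3 * (D + 1)) <= e by rewrite -ler_pdivlMr// ge_min lexx orbT.
exact: square_factor_le.
Qed.

(** Conversely, triangle inequalities for d(F1) and d(F2) whose convex combination
    is an equality are themselves equalities. *)
Lemma additive_along_split (a b : R) (gamma : R -> M) :
  (forall x y, finsler_dist F1 x y < +oo)%E ->
  (forall x y, finsler_dist F2 x y < +oo)%E ->
  (forall x y, finsler_dist F x y = dist_comb x y) ->
  additive_along F a b gamma ->
  additive_along F1 a b gamma /\ additive_along F2 a b gamma.
Proof.
move=> fin1 fin2 dE add.
have fn1 x y : finsler_dist F1 x y \is a fin_num.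
  by rewrite ge0_fin_numE ?finsler_dist_ge0.
have fn2 x y : finsler_dist F2 x y \is a fin_num.
  by rewrite ge0_fin_numE ?finsler_dist_ge0.
suff key u v w : a <= u -> u <= v -> v <= w -> w <= b ->
    (finsler_dist F1 (gamma u) (gamma v) + finsler_dist F1 (gamma v) (gamma w) =
     finsler_dist F1 (gamma u) (gamma w) /\
     finsler_dist F2 (gamma u) (gamma v) + finsler_dist F2 (gamma v) (gamma w) =
     finsler_dist F2 (gamma u) (gamma w))%E.
  by split=> u v w au uv vw wb; have [] := key u v w au uv vw wb.
move=> au uv vw wb; have := add u v w au uv vw wb; rewrite !dE => h.
apply: (convex_squeeze_ereal t0 t1) h => //; exact: finsler_dist_triangle.
Qed.

Lemma common_geodesic_comb (a b : R) (gamma : R -> M) : a <= b ->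
  (forall x y, finsler_dist F1 x y < +oo)%E ->
  (forall x y, finsler_dist F2 x y < +oo)%E ->
  (forall x y, finsler_dist F x y = dist_comb x y) ->
  is_geodesic F1 a b gamma -> is_geodesic F2 a b gamma ->
  is_geodesic F a b gamma.
Proof.
move=> ab fin1 fin2 dE g1 g2; apply: additive_geodesic => //.
- by case: g1.
- rewrite dE /dist_comb lte_add_pinfty// lte_mul_pinfty//.
  + by rewrite lee_fin weight_ge0.
  + by rewrite lee_fin ltW.
- move=> u v w au uv vw wb; rewrite !dE; apply: dist_comb_additive au uv vw wb.
    exact: geodesic_additive g1.
  exact: geodesic_additive g2.
Qed.

End comparison.

Theorem theorem5p1 (R : realType) (n : nat) (M : smooth_manifold R n)
    (F1 F2 : forall x : M, tangent M x -> R)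
    (hF1 : geodesic_finsler F1) (hF2 : geodesic_finsler F2)
    (t : R) (ht0 : 0 < t) (ht1 : t < 1) :
  let A :=
    geodesic_finsler (finsler_comb t F1 F2) /\
    (forall x y : M,
       finsler_dist (finsler_comb t F1 F2) x y =
       ((1 - t)%:E * finsler_dist F1 x y + t%:E * finsler_dist F2 x y)%E) in
  let B :=
    forall x y : M, exists (a b : R) (gamma : R -> M),
      [/\ a <= b, gamma a = x /\ gamma b = y, abs_continuous a b gamma,
          is_geodesic F1 a b gamma & is_geodesic F2 a b gamma] in
  (A <-> B) /\
  (B -> forall (a b : R) (gamma : R -> M),
     a <= b -> abs_continuous a b gamma ->
     is_geodesic F1 a b gamma -> is_geodesic F2 a b gamma ->
     is_geodesic (finsler_comb t F1 F2) a b gamma).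
Proof.
move=> A B.
have [f1 _] := hF1; have [f2 _] := hF2.
have f : finsler (finsler_comb t F1 F2) by exact: finsler_comb_finsler.
have fin1 := geodesic_finsler_dist_fin hF1.
have fin2 := geodesic_finsler_dist_fin hF2.
have BdE : B -> forall x y : M,
    finsler_dist (finsler_comb t F1 F2) x y = dist_comb F1 F2 t x y.
  move=> hB x y; have [a [b [g [ab [<- <-] _ g1 g2]]]] := hB x y.
  exact: finsler_dist_comb_geodesic.
have common : B -> forall (a b : R) (gamma : R -> M), a <= b ->
    is_geodesic F1 a b gamma -> is_geodesic F2 a b gamma ->
    is_geodesic (finsler_comb t F1 F2) a b gamma.
  by move=> hB a b g ab; apply: common_geodesic_comb => //; exact: BdE.
split; last by move=> hB a b g ab _; exact: common.
split=> [[[_ hF] dE] x y|hB].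
  have [a [b [g [ab gx gy ac gg]]]] := hF x y.
  have cg : {within `[a, b], continuous g} by case: gg.
  have [add1 add2] := additive_along_split f1 f2 ht0 ht1 fin1 fin2 dE
    (geodesic_additive f gg).
  by exists a, b, g; split => //; exact: additive_geodesic.
split; last exact: BdE.
split => // x y; have [a [b [g [ab [gx gy] ac g1 g2]]]] := hB x y.
by exists a, b, g; split => //; exact: common.
Qed.
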